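(* Let $X$ be a proper geodesic metric space with base point $\mathfrak{o}$. Then the contracting boundary $\partial_c X$, with the topology defined by the neighbourhoods $U(\mathbf{b},r)$, is metrizable.
   Context: **Setting.** $(X,d)$ is a proper geodesic metric space with base point $\mathfrak{o}$; $\|p\|:=d(\mathfrak{o},p)$. For $q\ge 1$, $Q\ge 0$, a $(q,Q)$-quasi-geodesic is a $(q,Q)$-quasi-isometric embedding of an interval; all quasi-geodesics are taken continuous, and all quasi-geodesic rays are based at (start at) $\mathfrak{o}$. A quasi-geodesic is identified with its image when convenient. A sublinear function is an increasing (i.e. non-decreasing), concave function $\rho:[0,\infty)\to[1,\infty)$ with $\lim_{x\to\infty}\rho(x)/x=0$. **Contracting boundary as a set.** For a closed $Z\subset X$ let $\pi_Z:X\to 2^Z$ be closest point projection. $Z$ is $\rho$-contracting, for a sublinear function $\rho$, if for all $x,y\in X$, $d(x,y)\le d(x,Z)$ implies $\operatorname{diam}(\pi_Z(x)\cup\pi_Z(y))\le\rho(d(x,Z))$; $Z$ is contracting if it is $\rho$-contracting for some sublinear $\rho$. $\partial_c X$ is the set of equivalence classes of contracting quasi-geodesic rays based at $\mathfrak{o}$, two being equivalent if they are at bounded Hausdorff distance. **Topology on $\partial_c X$.** For sublinear $\rho$, $q\ge1$, $Q\ge0$ set $$\kappa(\rho,q,Q)=\max\{3Q,\ 3q^2,\ 1+\inf\{R>0 \mid \forall r\ge R,\ 3q^2\rho(r)<r\}\}.$$ For each $\mathbf{b}\in\partial_c X$ fix a geodesic ray $b\in\mathbf{b}$ based at $\mathfrak{o}$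 and a sublinear function $\rho_b$ such that $b$ is $\rho_b$-contracting. For $r>0$, $U(\mathbf{b},r)$ is the set of $\mathbf{a}\in\partial_c X$ such that for all $q\ge1$, $Q\ge0$ and every continuous $(q,Q)$-quasi-geodesic ray $\alpha\in\mathbf{a}$, $$d(\alpha,\ b\cap\mathcal{N}_r^c\mathfrak{o})\le\kappa(\rho_b,q,Q),$$ where $\mathcal{N}_r^c\mathfrak{o}=\{p:\|p\|\ge r\}$ is the complement of the $r$-neighbourhood of $\mathfrak{o}$ and $d$ of two sets is the infimum of distances. A set $V\subset\partial_c X$ is open iff for every $\mathbf{b}\in V$ there is $r>0$ with $U(\mathbf{b},r)\subset V$. *)

(* Defs.v *)
From HB Require Import structures.
From mathcomp Require Import all_boot all_order all_algebra.
From mathcomp Require Import all_classical all_reals all_analysis.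

Set Implicit Arguments.
Unset Strict Implicit.
Unset Printing Implicit Defensive.

Import Order.TTheory GRing.Theory Num.Theory.
Import numFieldNormedType.Exports.

Local Open Scope classical_set_scope.
Local Open Scope ring_scope.

Section MetricSpace.
Context {R : realType} (X : metricType R).
Implicit Types (A B Z : set X) (x y : X) (rho : R -> R).

Definition proper_space := forall x (r : R), compact [set y | mdist x y <= r].

Definition geodesic_space := forall x y, exists g : R -> X,
  [/\ g 0 = x, g (mdist x y) = y &
      {in `[0, mdist x y] &, forall s t, mdist (g s) (g t) = `|s - t|}].

(* Distances between sets and diameters are extended reals, so that the
   empty and the unbounded case do not fall back on a default real value. *)
Definition set_dist A B : \bar R :=
  ereal_inf [set (mdist p.1 p.2)%:E | p in A `*` B].

Definition point_dist x Z : \bar R := set_dist [set x] Z.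

Definition diameter A : \bar R :=
  ereal_sup [set (mdist p.1 p.2)%:E | p in A `*` A].

Definition hausdorff_dist A B : \bar R :=
  maxe (ereal_sup [set point_dist a B | a in A])
       (ereal_sup [set point_dist b A | b in B]).

Definition closest_proj Z x : set X :=
  [set z | Z z /\ (mdist x z)%:E = point_dist x Z].

(* [rho] stands for a function on [0, +oo); its values at negative reals
   are irrelevant. *)
Definition sublinear rho :=
  [/\ {in `[0, +oo[, forall t, 1 <= rho t},
      {in `[0, +oo[ &, {homo rho : s t / s <= t}},
      @convex_function R R^o `[0, +oo[%classic (fun t => - rho t) &
      rho t / t @[t --> +oo] --> (0 : R)].

Definition contracting_with rho Z := closed Z /\
  forall x y, ((mdist x y)%:E <= point_dist x Z)%E ->
    (diameter (closest_proj Z x `|` closest_proj Z y)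
       <= (rho (fine (point_dist x Z)))%:E)%E.

Definition contracting Z :=
  exists2 rho, sublinear rho & contracting_with rho Z.

Definition qi_embedding_on (I : set R) (q Q : R) (f : R -> X) :=
  {in I &, forall s t,
     q^-1 * `|s - t| - Q <= mdist (f s) (f t) <= q * `|s - t| + Q}.

Variable o : X.

(* A ray is a map on [0, +oo), encoded as a function on [R] whose values at
   negative reals are irrelevant. *)
Definition ray_image (f : R -> X) : set X := f @` `[0, +oo[%classic.

Definition quasi_geodesic_ray (q Q : R) (f : R -> X) :=
  [/\ f 0 = o, {within `[0, +oo[%classic, continuous f} &
      qi_embedding_on `[0, +oo[%classic q Q f].

Definition geodesic_ray (f : R -> X) :=
  f 0 = o /\ {in `[0, +oo[ &, forall s t, mdist (f s) (f t) = `|s - t|}.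

Definition contracting_ray (f : R -> X) :=
  (exists q Q : R, [/\ 1 <= q, 0 <= Q & quasi_geodesic_ray q Q f]) /\
  contracting (ray_image f).

Definition equivalent_rays (f g : R -> X) :=
  (hausdorff_dist (ray_image f) (ray_image g) < +oo)%E.

Definition contracting_classes : set (set (R -> X)) :=
  [set C | exists2 f, contracting_ray f &
     C = [set g | contracting_ray g /\ equivalent_rays f g]].

Definition contracting_boundary : Type := set_type contracting_classes.

HB.instance Definition _ := Choice.on contracting_boundary.

Definition in_class (f : R -> X) (a : contracting_boundary) : Prop :=
  (val a : set (R -> X)) f.

Definition kappa rho (q Q : R) : R :=
  Num.max (Num.max (3 * Q) (3 * q ^+ 2))
    (1 + inf [set S | 0 < S /\ forall r, S <= r -> 3 * q ^+ 2 * rho r < r]).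

Definition outside_ball (r : R) : set X := [set p | r <= mdist o p].

(* [b] gives the chosen geodesic ray and [rho] the chosen contraction
   function in each class. *)
Definition boundary_nbhd (b : contracting_boundary -> R -> X)
    (rho : contracting_boundary -> R -> R) (c : contracting_boundary) (r : R) :
    set contracting_boundary :=
  [set a | forall q Q : R, 1 <= q -> 0 <= Q ->
     forall f, quasi_geodesic_ray q Q f -> in_class f a ->
     (set_dist (ray_image f) (ray_image (b c) `&` outside_ball r)
        <= (kappa (rho c) q Q)%:E)%E].

Definition boundary_choice (b : contracting_boundary -> R -> X)
    (rho : contracting_boundary -> R -> R) := forall c,
  [/\ in_class (b c) c, geodesic_ray (b c), sublinear (rho c) &
      contracting_with (rho c) (ray_image (b c))].

Lemma boundary_nbhd_decr (b : contracting_boundary -> R -> X)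
    (rho : contracting_boundary -> R -> R) c (r s : R) :
  r <= s -> boundary_nbhd b rho c s `<=` boundary_nbhd b rho c r.
Proof.
move=> rs a aU q Q q1 Q0 f fq fa; apply: le_trans (aU q Q q1 Q0 f fq fa).
apply: le_ereal_inf => _ [p [p1 [p2 ps]] <-]; exists p => //.
by split=> //; split=> //; exact: le_trans ps.
Qed.

(* The topology depends on the choice [b], [rho], hence so does the type
   that carries it. *)
Definition topological_boundary (b : contracting_boundary -> R -> X)
    (rho : contracting_boundary -> R -> R) : Type := contracting_boundary.

Section Topology.
Variables (b : contracting_boundary -> R -> X)
          (rho : contracting_boundary -> R -> R).

Local Notation boundary := (topological_boundary b rho).

HB.instance Definition _ := Choice.copy boundary contracting_boundary.

Definition boundary_open : set_system boundary :=
  [set V | forall c, V c -> exists2 r, 0 < r & boundary_nbhd b rho c r `<=` V].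

Let boundary_openT : boundary_open setT.
Proof. by move=> c _; exists 1. Qed.

Let boundary_openI : setI_closed boundary_open.
Proof.
move=> V W oV oW c [/oV[r r0 rV] /oW[s s0 sW]].
exists (Num.max r s); first by rewrite lt_max r0.
move=> a aU; split; [apply: rV | apply: sW];
  by apply: boundary_nbhd_decr aU; rewrite le_max lexx ?orbT.
Qed.

Let boundary_open_bigU (I : Type) (V : I -> set boundary) :
  (forall i, boundary_open (V i)) -> boundary_open (\bigcup_i V i).
Proof.
move=> oV c [i _ /oV[r r0 rV]]; exists r => //.
by move=> a /rV Va; exists i.
Qed.

HB.instance Definition _ := @isOpenTopological.Build boundary
  boundary_open boundary_openT boundary_openI boundary_open_bigU.

End Topology.
End MetricSpace.

Definition metrizable (R : realType) (T : topologicalType) :=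
  exists d : T -> T -> R,
    [/\ forall x y, 0 <= d x y,
        forall x y, d x y = 0 <-> x = y,
        forall x y, d x y = d y x,
        forall x y z, d x z <= d x y + d y z &
        forall V : set T, open V <->
          forall x, V x -> exists2 e, 0 < e & [set y | d x y < e] `<=` V].

(* Main.v *)
Require Import Defs.
From mathcomp Require Import all_boot all_order all_algebra.
From mathcomp Require Import all_classical all_reals all_analysis.
From mathcomp Require Import ring lra.

Set Implicit Arguments.
Unset Strict Implicit.
Unset Printing Implicit Defensive.

Import Order.TTheory GRing.Theory Num.Theory.
Import numFieldNormedType.Exports.

Local Open Scope classical_set_scope.
Local Open Scope ring_scope.

(** The contraction functions [rho c], and with them the constants [kappa], cannot be
    bounded uniformly in the boundary point [c], so the sets [U(c, r)] do not form a
    uniformity in an obvious way. Frink's theorem ([frink_metrization]) is made for this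
    situation: it suffices to find a decreasing neighbourhood base [V n c] of each
    point, with intersection the point, such that for all [x] and [n] there is [m],
    independent of [y], for which [V m y] is contained in [V n x] as soon as it meets
    [V m x]. Here [V n c] is [U(c, r)] for a radius [r] that is at least [n] and huge
    compared to the constants of [c] for [q, Q <= n + 1].

    Let [w] be in [V m y] and [z] in both [V m x] and [V m y], and let [f] be a
    quasi-geodesic ray in the class [w]. The aim is to bring [f] close to the geodesic
    ray [b x], while [f] is related to [z] only through [y], whose constants are out of
    control. Both [f] and the geodesic ray [b z] pass near the point of [b y] at a level
    that is huge compared to these constants. So [f] can be rerouted near that level
    and follow [b z] from there on, and if the place of the bridge is well chosen then
    the new ray has constants that depend only on [q] and [Q] ([exists_detour]). It is
    in the class [z] because contraction is invariant under bounded Hausdorff distance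
    ([contracting_of_bounded]). Since [z] is in [V m x], the new ray, and therefore the
    long initial part that it shares with [f], is close to [b x] up to a bound that
    depends on [x], [q] and [Q] only. Finally contraction improves this bound to the
    exact constant [kappa] at a slightly earlier time ([quasi_geodesic_approach]). Large
    [q] and [Q] impose no condition because the base point itself is within [kappa]
    of a far point of [b x]; this makes [m] independent of them.

    The geometric facts about a contracting geodesic ray all come from one estimate:
    as long as a quasi-geodesic is at distance at least [kappa] from the ray, its
    projection moves so slowly that it either comes back soon or leaves the ray at
    a linear rate ([excursion_time]). *)

(** * Frink's metrization theorem *)

Section ChainMetric.
Context {R : realType} (T : Type) (F : nat -> T -> T -> Prop).

Fixpoint chain (ks : seq nat) (x y : T) : Prop :=
  if ks is k :: ks' then exists2 z, F k x z & chain ks' z y else x = y.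

Definition chain_length (ks : seq nat) : R := \sum_(k <- ks) 2^-1 ^+ k.

Lemma chain_cat ks ls x y :
  chain (ks ++ ls) x y <-> exists2 z, chain ks x z & chain ls z y.
Proof.
elim: ks x => [|k ks IH] x /=; first by split => [c|[z ->]//]; exists x.
split => [[z Fxz /IH[u czu cuy]]|[u [z Fxz czu] cuy]].
  by exists u => //; exists z.
by exists z => //; apply/IH; exists u.
Qed.

Lemma chain_length_ge0 ks : 0 <= chain_length ks.
Proof. by apply: sumr_ge0 => k _; rewrite exprn_ge0. Qed.

Lemma chain_length_cat ks ls :
  chain_length (ks ++ ls) = chain_length ks + chain_length ls.
Proof. by rewrite /chain_length big_cat. Qed.

Lemma chain_length_cons k ks :
  chain_length (k :: ks) = 2^-1 ^+ k + chain_length ks.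
Proof. by rewrite /chain_length big_cons. Qed.

Lemma chain_split ks (h : R) : 0 <= h -> h < chain_length ks ->
  exists js k ls, [/\ ks = js ++ k :: ls, chain_length js <= h &
    h < chain_length js + 2^-1 ^+ k].
Proof.
elim: ks h => [|k ks IH] h h0; first by rewrite /chain_length big_nil ltNge h0.
rewrite chain_length_cons => hlt.
have [hk|kh] := ltP h (2^-1 ^+ k).
  by exists [::], k, ks; split; rewrite // /chain_length big_nil ?add0r.
have [||js [j [ls [-> jsh hj]]]] := IH (h - 2^-1 ^+ k); [lra|lra|].
by exists (k :: js), j, ls; split; rewrite // chain_length_cons; lra.
Qed.

Hypothesis F_refl : forall k x, F k x x.
Hypothesis F_sym : forall k x y, F k x y -> F k y x.
Hypothesis F_comp : forall k x y z w,
  F k.+1 x y -> F k.+1 y z -> F k.+1 z w -> F k x w.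

Lemma chain_comp_decr j k x y : (j <= k)%N -> F k x y -> F j x y.
Proof.
elim: k x y => [|k IH] x y; first by rewrite leqn0 => /eqP->.
rewrite leq_eqVlt => /orP[/eqP->//|jk Fxy]; apply: IH => //.
exact: F_comp Fxy (F_refl _ _) (F_refl _ _).
Qed.

Lemma half_expr_lt (j k : nat) : ((2^-1 : R) ^+ j < 2^-1 ^+ k) = (k < j)%N.
Proof. by rewrite ltr_iXn2l//; lra. Qed.

(** A chain that is shorter than [2^-k] is cut at the middle of its length: the
    two outer pieces are shorter than [2^-(k+1)], and so is the single step that
    straddles the middle, whence the threefold composition rule applies. *)
Lemma short_chain ks k x y : chain_length ks < 2^-1 ^+ k -> chain ks x y ->
  F k x y.
Proof.
have [n] := ubnP (size ks); elim: n ks k x y => // n IH ks k x y szks short.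
have [len0|len0] := leP (chain_length ks) 0.
  case: ks len0 {szks short} => [|j ks]; first by move=> _ /= ->.
  have := exprn_gt0 j (_ : 0 < 2^-1 :> R); have := chain_length_ge0 ks.
  by rewrite chain_length_cons invr_gt0 ltr0n => ? /(_ isT) ?; lra.
have [||js [j [ls [eks jsh hj]]]] := @chain_split ks (chain_length ks / 2).
- by lra.
- by lra.
move: szks short len0 jsh hj; rewrite {ks}eks.
rewrite size_cat /= chain_length_cat chain_length_cons => szks short len0 jsh hj.
have halfk : (2^-1 : R) ^+ k.+1 = 2^-1 ^+ k / 2 by rewrite exprS mulrC.
have lsge := chain_length_ge0 ls; have jsge := chain_length_ge0 js.
move=> /chain_cat[u cxu [v Fuv cvy]].
apply: (@F_comp _ _ u v); [apply: IH cxu|apply: chain_comp_decr Fuv|apply: IH cvy].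
- by move: szks; rewrite addnS ltnS; apply: leq_ltn_trans; rewrite leq_addr.
- by rewrite halfk; lra.
- by rewrite -half_expr_lt; lra.
- by move: szks; rewrite addnS ltnS; apply: leq_ltn_trans; rewrite leq_addl.
- by rewrite halfk; lra.
Qed.

Hypothesis F_total : forall x y, F 0 x y.

Definition chain_dist (x y : T) : R :=
  inf [set chain_length ks | ks in [set ks | chain ks x y]].

Lemma has_inf_chain x y :
  has_inf [set chain_length ks | ks in [set ks | chain ks x y]].
Proof.
split; first by exists (chain_length [:: 0%N]); exists [:: 0%N] => //=; exists y.
by exists 0 => _ [ks _ <-]; exact: chain_length_ge0.
Qed.

Lemma chain_dist_le ks x y : chain ks x y -> chain_dist x y <= chain_length ks.
Proof. by move=> c; apply: ge_inf; [case: (has_inf_chain x y)|exists ks]. Qed.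

Lemma chain_dist_lt x y e : chain_dist x y < e ->
  exists2 ks, chain ks x y & chain_length ks < e.
Proof.
move=> de; have e0 : 0 < e - chain_dist x y by rewrite subr_gt0.
have [_ [ks c <-]] := inf_adherent e0 (has_inf_chain x y).
by rewrite -/(chain_dist x y) addrC subrK; exists ks.
Qed.

Lemma chain_dist_ge0 x y : 0 <= chain_dist x y.
Proof.
apply: lb_le_inf; first by case: (has_inf_chain x y).
by move=> _ [ks _ <-]; exact: chain_length_ge0.
Qed.

Lemma chain_distxx x : chain_dist x x = 0.
Proof.
apply/eqP; rewrite eq_le chain_dist_ge0 andbT.
by rewrite (le_trans (@chain_dist_le [::] x x _))// /chain_length big_nil.
Qed.

Lemma chain_rev ks x y : chain ks x y -> chain (rev ks) y x.
Proof.
elim: ks x => [|k ks IH] x //= [z Fxz /IH c].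
by rewrite rev_cons -cats1; apply/chain_cat; exists z => //=; exists x;
  [exact: F_sym|].
Qed.

Lemma chain_length_rev ks : chain_length (rev ks) = chain_length ks.
Proof. by rewrite /chain_length; apply: perm_big; rewrite perm_rev. Qed.

Lemma chain_dist_sym x y : chain_dist x y = chain_dist y x.
Proof.
suff le_d u v : chain_dist u v <= chain_dist v u.
  by apply/eqP; rewrite eq_le !le_d.
rewrite leNgt; apply/negP => /chain_dist_lt[ks /chain_rev c].
by rewrite -chain_length_rev ltNge chain_dist_le.
Qed.

Lemma chain_dist_triangle x y z :
  chain_dist x z <= chain_dist x y + chain_dist y z.
Proof.
apply/ler_addgt0Pr => e e0.
have [|ks cxy lks] := @chain_dist_lt x y (chain_dist x y + e / 2); first by lra.
have [|ls cyz lls] := @chain_dist_lt y z (chain_dist y z + e / 2); first by lra.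
have /chain_dist_le : chain (ks ++ ls) x z by apply/chain_cat; exists y.
by rewrite chain_length_cat; lra.
Qed.

Lemma chain_dist_small k x y : chain_dist x y < 2^-1 ^+ k -> F k x y.
Proof. by move=> /chain_dist_lt[ks c l]; exact: short_chain c. Qed.

Lemma chain_dist_step k x y : F k x y -> chain_dist x y <= 2^-1 ^+ k.
Proof.
move=> Fxy; have -> : 2^-1 ^+ k = chain_length [:: k].
  by rewrite chain_length_cons /chain_length big_nil addr0.
by apply: chain_dist_le; exists y.
Qed.

End ChainMetric.

Section Frink.
Context {R : realType} (T : Type) (V : nat -> T -> set T) (m : T -> nat -> nat).
Hypothesis V_center : forall n x, V n x x.
Hypothesis V_decr : forall i j x, (i <= j)%N -> V j x `<=` V i x.
Hypothesis V_swallow : forall x n y,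
  V (m x n) x `&` V (m x n) y !=set0 -> V (m x n) y `<=` V n x.
Hypothesis V_separated : forall x y, (forall n, V n x y) -> x = y.

(** Although the modulus [m] depends on the point, iterating it at every point
    yields a uniformity: of two sets [V (frink_index x k.+1) x] that meet, the one
    with the larger index is absorbed by [V (frink_index x k) x] for the center
    [x] of the one with the smaller index, whatever the modulus of the other
    center is. *)
Fixpoint frink_index (x : T) (k : nat) : nat :=
  if k is k'.+1 then maxn (m x (frink_index x k')) (frink_index x k').+1 else 0%N.

Definition frink_entourage (k : nat) (y z : T) : Prop :=
  exists x, V (frink_index x k) x y /\ V (frink_index x k) x z.

Lemma frink_index_ge x k : (k <= frink_index x k)%N.
Proof. by elim: k => //= k IH; rewrite leq_max ltnS IH orbT. Qed.

Lemma frink_absorb x k j y : (frink_index x k.+1 <= j)%N ->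
  V (frink_index x k.+1) x `&` V j y !=set0 -> V j y `<=` V (frink_index x k) x.
Proof.
rewrite /= geq_max => /andP[mj _] [z [Vxz Vyz]].
apply: subset_trans (V_decr mj) _; apply: V_swallow.
by exists z; split; [apply: V_decr Vxz; rewrite leq_maxl|apply: V_decr Vyz].
Qed.

Lemma frink_entourage_refl k x : frink_entourage k x x.
Proof. by exists x. Qed.

Lemma frink_entourage_sym k x y : frink_entourage k x y -> frink_entourage k y x.
Proof. by move=> [z [zx zy]]; exists z. Qed.

Lemma frink_entourage_comp k x y z :
  frink_entourage k.+1 x y -> frink_entourage k.+1 y z -> frink_entourage k x z.
Proof.
move=> [u [ux uy]] [v [vy vz]].
have [uv|/ltnW vu] := leqP (frink_index u k.+1) (frink_index v k.+1).
- have absorb : V (frink_index v k.+1) v `<=` V (frink_index u k) u.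
    by apply: frink_absorb => //; exists y.
  exists u; split; last exact: absorb.
  by apply: V_decr ux; rewrite /= leq_max leqnSn orbT.
- have absorb : V (frink_index u k.+1) u `<=` V (frink_index v k) v.
    by apply: frink_absorb => //; exists y.
  exists v; split; first exact: absorb.
  by apply: V_decr vz; rewrite /= leq_max leqnSn orbT.
Qed.

Lemma frink_entourage_decr k x y :
  frink_entourage k.+1 x y -> frink_entourage k x y.
Proof. by move=> /frink_entourage_comp; apply; exact: frink_entourage_refl. Qed.

Lemma frink_entourage_small x n :
  exists k, forall y, frink_entourage k x y -> V n x y.
Proof.
exists (m x n) => y [u [ux uy]].
have ge_m := frink_index_ge u (m x n).
by apply: (V_swallow (y := u)); [exists x; split|];
  [exact: V_center|exact: V_decr ux|exact: V_decr uy].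
Qed.

(* Only every other entourage is kept, so as to have a threefold composition
   rule; the total relation in front makes all chain distances finite. *)
Let F (k : nat) : T -> T -> Prop :=
  if k is k'.+1 then frink_entourage k'.*2 else fun _ _ => True.

Let F_comp k x y z w : F k.+1 x y -> F k.+1 y z -> F k.+1 z w -> F k x w.
Proof.
case: k => //= k xy yz zw; apply: (frink_entourage_comp (y := z)).
  exact: frink_entourage_comp yz.
exact: frink_entourage_decr.
Qed.

Let F_refl k x : F k x x.
Proof. by case: k => //= k; exact: frink_entourage_refl. Qed.

Let F_sym k x y : F k x y -> F k y x.
Proof. by case: k => //= k; exact: frink_entourage_sym. Qed.

Let F_small x n : exists k, forall y, F k x y -> V n x y.
Proof.
have [k kP] := frink_entourage_small x n; exists k.+1 => y /= E2k; apply: kP.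
suff decr i j : (i <= j)%N -> frink_entourage j x y -> frink_entourage i x y.
  by apply: decr E2k; rewrite -addnn leq_addr.
elim: j => [|j IH]; first by rewrite leqn0 => /eqP->.
rewrite leq_eqVlt => /orP[/eqP->//|ij /frink_entourage_decr]; exact: IH.
Qed.

Let half_expr_small (e : R) : 0 < e -> exists k, 2^-1 ^+ k < e.
Proof.
move=> e0; have : (2^-1 : R) ^+ n @[n --> \oo] --> (0 : R).
  by apply: cvg_expr; rewrite ger0_norm; lra.
move/cvgrPdist_lt => /(_ e e0)[k _ /(_ k (leqnn k))] /=.
by rewrite sub0r normrN ger0_norm ?exprn_ge0//; exists k.
Qed.

Lemma frink_metrization_modulus : exists d : T -> T -> R,
  [/\ forall x y, 0 <= d x y,
      forall x y, d x y = 0 <-> x = y,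
      forall x y, d x y = d y x,
      forall x y z, d x z <= d x y + d y z &
      forall S : set T, (forall x, S x -> exists n, V n x `<=` S) <->
        forall x, S x -> exists2 e, 0 < e & [set y | d x y < e] `<=` S].
Proof.
have F0 x y : F 0 x y by [].
have half0 k : 0 < (2^-1 : R) ^+ k by rewrite exprn_gt0// invr_gt0 ltr0n.
have small := @chain_dist_small R T F F_refl F_comp F0.
exists (@chain_dist R T F); split.
- exact: chain_dist_ge0 F0.
- move=> x y; split => [d0|->]; last exact: chain_distxx F0 _.
  apply: V_separated => n; have [k kP] := F_small x n.
  by apply: kP; apply: small; rewrite d0.
- exact: chain_dist_sym.
- exact: chain_dist_triangle.
- move=> S; split => oS x Sx.
  + have [n nS] := oS x Sx; have [k kP] := F_small x n.
    by exists (2^-1 ^+ k) => // y /= dk; apply: nS; apply: kP; exact: small.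
  + have [e e0 eS] := oS x Sx; have [k ke] := half_expr_small e0.
    exists (frink_index x k.*2) => y Vy; apply: eS => /=.
    apply: le_lt_trans ke; apply: (@le_trans _ _ (2^-1 ^+ k.+1)).
      by apply: (chain_dist_step F0); rewrite /F; exists x; split.
    by have := half0 k; rewrite exprS; lra.
Qed.

End Frink.

(** Frink's metrization theorem. Its strength is that [m] may depend on the point [x]
    in an arbitrary way. *)
Theorem frink_metrization (R : realType) (T : Type) (V : nat -> T -> set T) :
  (forall n x, V n x x) ->
  (forall i j x, (i <= j)%N -> V j x `<=` V i x) ->
  (forall x n, exists m, forall y, V m x `&` V m y !=set0 -> V m y `<=` V n x) ->
  (forall x y, (forall n, V n x y) -> x = y) ->
  exists d : T -> T -> R,
  [/\ forall x y, 0 <= d x y,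
      forall x y, d x y = 0 <-> x = y,
      forall x y, d x y = d y x,
      forall x y z, d x z <= d x y + d y z &
      forall S : set T, (forall x, S x -> exists n, V n x `<=` S) <->
        forall x, S x -> exists2 e, 0 < e & [set y | d x y < e] `<=` S].
Proof.
move=> Vc Vd /(_ _ _)/cid Vm Vs.
exact: (@frink_metrization_modulus R T V (fun x n => sval (Vm x n)) Vc Vd
  (fun x n => svalP (Vm x n)) Vs).
Qed.

(** * Continuity and distances in metric spaces *)

Section Continuity.
Context {R : realType} (X : metricType R).

Lemma within_continuous_mdistP (f : R -> X) (A : set R) :
  {within A, continuous f} <->
  forall x, A x -> forall e : R, 0 < e -> exists2 d, 0 < d &
    forall y, A y -> `|x - y| < d -> mdist (f x) (f y) < e.
Proof.
split => [/subspace_continuousP cf x Ax e e0|cf].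
  move: (cf x Ax) => /metricType_numDomainType.cvgrPdist_lt /(_ e e0).
  rewrite near_withinE => /nbhs_ballP[d /= d0 dP]; exists d => // y Ay xy.
  exact: dP.
apply/subspace_continuousP => x Ax.
apply/metricType_numDomainType.cvgrPdist_lt => e e0.
have [d d0 dP] := cf x Ax e e0.
rewrite near_withinE; apply/nbhs_ballP; exists d => //= y xy Ay.
exact: dP.
Qed.

Lemma within_continuous_normP (f : R -> R) (A : set R) :
  {within A, continuous f} <->
  forall x, A x -> forall e : R, 0 < e -> exists2 d, 0 < d &
    forall y, A y -> `|x - y| < d -> `|f x - f y| < e.
Proof.
split => [/subspace_continuousP cf x Ax e e0|cf].
  move: (cf x Ax) => /cvgrPdist_lt /(_ e e0).
  rewrite near_withinE => /nbhs_ballP[d /= d0 dP]; exists d => // y Ay xy.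
  exact: dP.
apply/subspace_continuousP => x Ax; apply/cvgrPdist_lt => e e0.
have [d d0 dP] := cf x Ax e e0.
rewrite near_withinE; apply/nbhs_ballP; exists d => //= y xy Ay.
exact: dP.
Qed.

Lemma continuous_lipschitz_comp (phi : X -> R) (f : R -> X) (A B : set R) :
  (forall x y, phi x <= mdist x y + phi y) -> B `<=` A ->
  {within A, continuous f} -> {within B, continuous (phi \o f)}.
Proof.
move=> lip BA /within_continuous_mdistP cf; apply/within_continuous_normP.
move=> x Bx e e0; have [d d0 dP] := cf x (BA _ Bx) e e0; exists d => // y By xy.
apply: le_lt_trans (dP y (BA _ By) xy) => /=.
have := lip (f x) (f y); have := lip (f y) (f x).
by rewrite (metric_sym (f y)) ler_norml => ? ?; apply/andP; split; lra.
Qed.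

Lemma isometry_within_continuous (f : R -> X) (A : set R) :
  (forall s t, A s -> A t -> mdist (f s) (f t) = `|s - t|) ->
  {within A, continuous f}.
Proof.
move=> iso; apply/within_continuous_mdistP => x Ax e e0.
by exists e => // y Ay xy; rewrite iso.
Qed.

Lemma last_passage (g : R -> R) (a c k : R) : a <= c ->
  {within `[a, c], continuous g} -> g a <= k -> k < g c ->
  exists s, [/\ a <= s <= c, g s = k & forall u, s < u -> u <= c -> k < g u].
Proof.
move=> ac cg gak kgc; pose A := [set u | [/\ a <= u, u <= c & g u <= k]].
have supA : has_sup A by split; [exists a|exists c => u []].
have ltsupA u : sup A < u -> u <= c -> k < g u.
  move=> su uc; rewrite ltNge; apply/negP => guk.
  have : u <= sup A.
    apply: ub_le_sup; [by case: supA|split => //].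
    apply: le_trans (ltW su); apply: ub_le_sup; [by case: supA|by split].
  by rewrite leNgt su.
have as_ : a <= sup A by apply: ub_le_sup; [by case: supA|by split].
have sc : sup A <= c by apply: ge_sup; [by case: supA|move=> u []].
have gsk : g (sup A) <= k.
  rewrite leNgt; apply/negP => kgs; move/within_continuous_normP: cg.
  have sac : `[a, c]%classic (sup A) by rewrite /= in_itv /= as_.
  move=> /(_ (sup A) sac (g (sup A) - k)); rewrite subr_gt0.
  move=> /(_ kgs)[d d0 dP]; have [u Au su] := sup_adherent d0 supA.
  have us : u <= sup A by apply: ub_le_sup => //; case: supA.
  case: Au => au uc guk.
  have := dP u; rewrite /= in_itv /= au uc => /(_ isT).
  rewrite ger0_norm ?subr_ge0// => /(_ ltac:(lra)).
  by rewrite ger0_norm; lra.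
exists (sup A); split; rewrite ?as_//.
have [||v] := @IVT R g (sup A) c k sc.
- apply: continuous_subspaceW cg => u /=; rewrite !in_itv /= => /andP[su ->].
  by rewrite (le_trans as_).
- by rewrite ge_min gsk /= le_max (ltW kgc) orbT.
rewrite in_itv /= => /andP[sv vc] gv.
case: (ltP (sup A) v) => [/ltsupA/(_ vc)|vs]; first by rewrite gv ltxx.
by rewrite -gv; congr (g _); apply/eqP; rewrite eq_le sv.
Qed.

Lemma first_passage (g : R -> R) (a c k : R) : a <= c ->
  {within `[a, c], continuous g} -> k < g a -> g c <= k ->
  exists s, [/\ a <= s <= c, g s = k & forall u, a <= u -> u < s -> k < g u].
Proof.
move=> ac cg kga gck.
have [||||s []] := @last_passage (g \o -%R) (- c) (- a) k.
- by rewrite lerN2.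
- by apply: within_continuous_compN; rewrite !opprK.
- by rewrite /= opprK.
- by rewrite /= opprK.
move=> sac gs sP; exists (- s); split => // [|u au us]; first lra.
by have := sP (- u); rewrite /= opprK; apply; lra.
Qed.

End Continuity.

Section PointDistance.
Context {R : realType} (X : metricType R).
Implicit Types (x y z : X) (Z : set X).

(** Real-valued version of [point_dist]; for empty [Z] it has the default value of
    [inf]. *)
Definition pdist x Z : R := inf [set mdist x z | z in Z].

Let has_lbound_dist x Z : has_lbound [set mdist x z | z in Z].
Proof. by exists 0 => _ [z _ <-]; exact: mdist_ge0. Qed.

Lemma point_distE x Z : Z !=set0 -> point_dist x Z = (pdist x Z)%:E.
Proof.
move=> [z Zz]; rewrite /pdist -ereal_inf_EFin//; last by exists (mdist x z), z.
congr ereal_inf; apply/seteqP; split => [_ [[_ u] [/= -> Zu] <-]|_ [_ [u Zu <-] <-]].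
  by exists (mdist x u) => //; exists u.
by exists (x, u).
Qed.

Lemma pdist_le x Z z : Z z -> pdist x Z <= mdist x z.
Proof. by move=> Zz; apply: ge_inf => //; exists z. Qed.

Lemma pdist_ge0 x Z : Z !=set0 -> 0 <= pdist x Z.
Proof.
move=> [z Zz]; apply: lb_le_inf; first by exists (mdist x z), z.
by move=> _ [u _ <-]; exact: mdist_ge0.
Qed.

Lemma pdist_lt x Z (e : R) : Z !=set0 -> pdist x Z < e ->
  exists2 z, Z z & mdist x z < e.
Proof.
move=> [z Zz] xe; have e0 : 0 < e - pdist x Z by rewrite subr_gt0.
have [|_ [u Zu <-]] := inf_adherent e0 (_ : has_inf [set mdist x z | z in Z]).
  by split => //; exists (mdist x z), z.
by rewrite -/(pdist x Z) addrC subrK; exists u.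
Qed.

Lemma pdist_lipschitz Z : Z !=set0 ->
  forall x y, pdist x Z <= mdist x y + pdist y Z.
Proof.
move=> Z0 x y; apply/ler_addgt0Pr => e e0.
have [|z Zz yz] := @pdist_lt y Z (pdist y Z + e) Z0; first by rewrite ltrDl.
have := @pdist_le x Z z Zz; have := metric_triangle x y z; lra.
Qed.

Lemma set_dist_le (A B : set X) a b (r : R) : A a -> B b -> mdist a b <= r ->
  (set_dist A B <= r%:E)%E.
Proof.
move=> Aa Bb abr; apply: (@le_trans _ _ (mdist a b)%:E); last by rewrite lee_fin.
by apply: ereal_inf_lbound; exists (a, b).
Qed.

Lemma set_dist_near (A B : set X) (r e : R) : (set_dist A B <= r%:E)%E ->
  r < e -> exists a b, [/\ A a, B b & mdist a b < e].
Proof.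
move=> AB re; apply/not_existsP => far.
suff : (e%:E <= set_dist A B)%E.
  by move=> /le_trans/(_ AB); rewrite lee_fin leNgt re.
apply: le_ereal_inf_tmp => _ [[a b] [/= Aa Bb] <-]; rewrite lee_fin leNgt.
by apply/negP => ab; apply: (far a); exists b.
Qed.

Lemma hausdorff_bounded (A B : set X) : (hausdorff_dist A B < +oo)%E <->
  exists C : R, (forall a, A a -> (point_dist a B <= C%:E)%E) /\
                (forall b, B b -> (point_dist b A <= C%:E)%E).
Proof.
split => [|[C [AB BA]]]; last first.
  apply: (@le_lt_trans _ _ C%:E); last by rewrite ltry.
  by rewrite ge_max; apply/andP; split; apply: ge_ereal_sup => _ [a Aa <-]; auto.
rewrite /hausdorff_dist; set m := maxe _ _ => mfin.
have [C mC] : exists C : R, (m <= C%:E)%E.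
  by case: m mfin => [C _|//|_]; [exists C|exists 0; rewrite leNye].
move: mC; rewrite ge_max => /andP[AC BC].
by exists C; split => u Du; [apply: le_trans AC|apply: le_trans BC];
  apply: ereal_sup_ubound; exists u.
Qed.

End PointDistance.

(** * Quasi-geodesic rays and contraction *)

Section Kappa.
Context {R : realType}.
Implicit Types (rho : R -> R) (q Q r : R).

Lemma kappa_ge rho q Q : [/\ 3 * Q <= kappa rho q Q, 3 * q ^+ 2 <= kappa rho q Q &
  1 + inf [set S | 0 < S /\ forall r, S <= r -> 3 * q ^+ 2 * rho r < r]
    <= kappa rho q Q].
Proof. by rewrite /kappa; split; rewrite !le_max lexx ?orbT. Qed.

(** This makes the infimum in [kappa] range over a nonempty set. *)
Lemma sublinear_eventually_lt rho a : sublinear rho -> 0 < a ->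
  exists2 S, 0 < S & forall r, S <= r -> a * rho r < r.
Proof.
move=> [rho1 _ _ rho_lim] a0.
have ia0 : 0 < a^-1 by rewrite invr_gt0.
move/cvgrPdist_lt: rho_lim => /(_ _ ia0)[M [_ MP]].
exists (Num.max 1 (M + 1)) => [|r]; first by rewrite lt_max ltr01.
rewrite ge_max => /andP[r1 Mr]; have r0 : 0 < r by lra.
have := MP r; rewrite sub0r normrN => /(_ ltac:(lra)) /(le_lt_trans (ler_norm _)).
by rewrite ltr_pdivrMr// mulrC ltr_pdivlMr// mulrC.
Qed.

Lemma kappa_lt rho q Q r : sublinear rho -> 1 <= q -> kappa rho q Q <= r ->
  3 * q ^+ 2 * rho r < r.
Proof.
move=> srho q1 kr; have [_ _ infk] := kappa_ge rho q Q.
have a0 : 0 < 3 * q ^+ 2 by rewrite mulr_gt0// exprn_gt0; lra.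
have [S S0 SP] := sublinear_eventually_lt srho a0.
set A := [set S | _] in infk.
have hA : has_inf A by split; [exists S|exists 0 => u [/ltW]].
have [u [_ uP] ult] := inf_adherent (@ltr01 R) hA.
by apply: uP; lra.
Qed.

End Kappa.

Section Rays.
Context {R : realType} (X : metricType R) (o : X).
Implicit Types (f b : R -> X) (q Q : R).

Lemma ray_imageP f t : 0 <= t -> ray_image f (f t).
Proof. by move=> t0; exists t => //=; rewrite in_itv /= t0. Qed.

Lemma ray_image_nonempty f : ray_image f !=set0.
Proof. by exists (f 0); exact: ray_imageP. Qed.

Lemma quasi_geodesic_ray_le q Q f s t : quasi_geodesic_ray o q Q f ->
  0 <= s -> s <= t ->
  q^-1 * (t - s) - Q <= mdist (f s) (f t) /\ mdist (f s) (f t) <= q * (t - s) + Q.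
Proof.
move=> [_ _ qi] s0 st; have := qi s t; rewrite !inE /= !in_itv /= !andbT s0.
rewrite (le_trans s0 st) distrC ger0_norm ?subr_ge0//.
by move=> /(_ isT isT)/andP[].
Qed.

Lemma quasi_geodesic_ray_norm q Q f t : quasi_geodesic_ray o q Q f -> 0 <= t ->
  q^-1 * t - Q <= mdist o (f t) /\ mdist o (f t) <= q * t + Q.
Proof.
move=> qf t0; have := quasi_geodesic_ray_le qf (lexx 0) t0.
by rewrite subr0; case: qf => ->.
Qed.

Lemma quasi_geodesic_ray_continuous q Q f (phi : X -> R) s t :
  quasi_geodesic_ray o q Q f -> (forall x y, phi x <= mdist x y + phi y) ->
  0 <= s -> {within `[s, t], continuous (phi \o f)}.
Proof.
move=> [_ cf _] lip s0; apply: (continuous_lipschitz_comp lip) cf => u /=.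
by rewrite !in_itv /= andbT => /andP[su _]; exact: le_trans su.
Qed.

Lemma mdist_lipschitz (p x y : X) : mdist p x <= mdist x y + mdist p y.
Proof. by rewrite addrC (metric_sym x) metric_triangle. Qed.

Lemma quasi_geodesic_ray_weaken q Q q' Q' f : 1 <= q -> q <= q' -> Q <= Q' ->
  quasi_geodesic_ray o q Q f -> quasi_geodesic_ray o q' Q' f.
Proof.
move=> q1 qq' QQ' [f0 cf qi]; split => // s t s0 t0.
have [lo up] := andP (qi s t s0 t0).
have q0 : 0 < q by lra.
have q'0 : 0 < q' by lra.
have iq : q'^-1 <= q^-1 by rewrite lef_pV2.
apply/andP; split.
  apply: le_trans lo; rewrite lerB// ler_wpM2r//.
by apply: le_trans up _; rewrite lerD// ler_wpM2r.
Qed.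

Lemma geodesic_ray_mdist b s t : geodesic_ray o b -> 0 <= s -> 0 <= t ->
  mdist (b s) (b t) = `|s - t|.
Proof. by move=> [_ iso] s0 t0; apply: iso; rewrite in_itv /= ?s0 ?t0. Qed.

Lemma geodesic_ray_norm b t : geodesic_ray o b -> 0 <= t -> mdist o (b t) = t.
Proof.
move=> gb t0; have := geodesic_ray_mdist gb (lexx 0) t0.
by rewrite sub0r normrN ger0_norm//; case: gb => ->.
Qed.

Lemma geodesic_ray_quasi_geodesic b : geodesic_ray o b ->
  quasi_geodesic_ray o 1 0 b.
Proof.
move=> [b0 iso]; split => //; last first.
  by move=> s t; rewrite !inE /= => s0 t0; rewrite iso// invr1 !mul1r subr0 addr0 lexx.
apply: isometry_within_continuous => s t /= s0 t0; exact: iso.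
Qed.

(** Beyond the parameter [2 * d(o, x)] the points of the ray are further from
    [x] than [o] is, so the minimum over a compact segment is global. *)
Lemma geodesic_ray_nearest b x : geodesic_ray o b ->
  exists2 t, 0 <= t & mdist x (b t) = pdist x (ray_image b).
Proof.
move=> gb; have T0 : 0 <= 2 * mdist o x by rewrite mulr_ge0// mdist_ge0.
have cb := @quasi_geodesic_ray_continuous _ _ _ (mdist x) 0 (2 * mdist o x)
  (geodesic_ray_quasi_geodesic gb) (mdist_lipschitz x) (lexx 0).
have [t /= + tmin] := EVT_min T0 cb; rewrite in_itv /= => /andP[t0 _].
exists t => //; apply/eqP; rewrite eq_le pdist_le ?andbT; last exact: ray_imageP.
apply: lb_le_inf; first by exists (mdist x (b t)), (b t) => //; exact: ray_imageP.
move=> _ [_ [u + <-] <-]; rewrite /= in_itv /= andbT => u0.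
have [uT|Tu] := leP u (2 * mdist o x).
  by apply: tmin; rewrite in_itv /= u0.
apply: (@le_trans _ _ (mdist x (b 0))).
  by apply: tmin; rewrite in_itv /= lexx.
have := metric_triangle o x (b u); rewrite (geodesic_ray_norm gb u0).
have -> : b 0 = o by case: gb.
by rewrite (metric_sym x o); lra.
Qed.

End Rays.

Section Contraction.
Context {R : realType} (X : metricType R) (Z : set X) (rho : R -> R).
Hypothesis Z0 : Z !=set0.

(** The inequality of [contracting_with] in terms of real distances, stated for
    pairs of nearest points; closedness of [Z] is left out. *)
Definition contracts := forall x y z w, mdist x y <= pdist x Z ->
  Z z -> mdist x z = pdist x Z -> Z w -> mdist y w = pdist y Z ->
  mdist z w <= rho (pdist x Z).

Lemma contracting_with_contracts : contracting_with rho Z -> contracts.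
Proof.
move=> [_ cZ] x y z w xy Zz xz Zw yw.
have := cZ x y; rewrite point_distE// lee_fin => /(_ xy); rewrite /= => diam.
rewrite -lee_fin; apply: le_trans diam; apply: ereal_sup_ubound.
exists (z, w) => //; split; [left|right]; split => //.
  by rewrite point_distE// xz.
by rewrite point_distE// yw.
Qed.

End Contraction.

(** * Quasi-geodesics near a contracting geodesic ray *)

Section QuasiGeodesicImage.
Context {R : realType} (X : metricType R) (o : X).
Variables (b f : R -> X) (rho : R -> R) (q Q : R).
Hypotheses (gb : geodesic_ray o b) (srho : sublinear rho)
  (cb : contracts (ray_image b) rho).
Hypotheses (q1 : 1 <= q) (Q0 : 0 <= Q) (qf : quasi_geodesic_ray o q Q f).

Local Notation Z := (ray_image b).
Local Notation K := (kappa rho q Q).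
Local Notation dZ t := (pdist (f t) Z).

Lemma kappa_bounds : [/\ 3 * Q <= K, 3 * q ^+ 2 <= K & 3 <= K].
Proof.
have [KQ Kq _] := kappa_ge rho q Q; split => //.
by apply: le_trans Kq; rewrite ler_peMr// exprn_ege1.
Qed.

Lemma quasi_geodesic_upper s t : 0 <= s -> s <= t ->
  mdist (f s) (f t) <= q * (t - s) + Q.
Proof. by move=> s0 st; case: (quasi_geodesic_ray_le qf s0 st). Qed.

Lemma short_drift s T x y : 0 <= s -> s <= T -> K <= dZ s ->
  mdist (f s) (f T) <= dZ s ->
  Z x -> mdist (f s) x = dZ s -> Z y -> mdist (f T) y = dZ T ->
  6 * q * mdist x y <= 3 * (T - s) + 2 * q * (Q + dZ T).
Proof.
have [hq hQ] : 1 <= q /\ 0 <= Q by []; have q0 : 0 < q by lra.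
move=> s0 sT far near Zx xs Zy yT.
have xy := cb near Zx xs Zy yT.
have small := kappa_lt srho q1 far.
have lip := pdist_lipschitz (ray_image_nonempty b) (f s) (f T).
have up := quasi_geodesic_upper s0 sT.
have T0 := pdist_ge0 (f T) (ray_image_nonempty b).
move: xy small lip up T0; set r := dZ s; set dT := dZ T; set m := mdist x y.
set e := mdist _ _ => xy small lip up T0.
have mq : 3 * q ^+ 2 * m <= q * (T - s) + (Q + dT).
  have : 3 * q ^+ 2 * m <= 3 * q ^+ 2 * rho r.
    by rewrite ler_wpM2l// mulr_ge0// exprn_ge0// ltW.
  by lra.
rewrite -(ler_pM2l q0); have Ts : 0 <= q * (T - s) by apply: mulr_ge0; lra.
have QT : Q + dT <= q ^+ 2 * (Q + dT).
  by rewrite ler_peMl ?exprn_ege1//; lra.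
have -> : q * (6 * q * m) = 2 * (3 * q ^+ 2 * m) by ring.
have -> : q * (3 * (T - s) + 2 * q * (Q + dT)) =
  3 * (q * (T - s)) + 2 * (q ^+ 2 * (Q + dT)) by ring.
by lra.
Qed.

(** Walk along [f] in steps from [f s] to a point at distance [r], where [r] is the
    distance from [f s] to [Z]. By contraction each step moves the projection by at
    most [rho r], which is less than [r / (3 q^2)] because [r] is at least [K],
    whereas the step takes time about [r / q]: the projection drifts at less than
    half the speed of [f]. Each step takes time at least [1], so [n] steps suffice. *)
Lemma projection_drift (n : nat) s T x y : 0 <= s -> s <= T -> T - s <= n%:R ->
  (forall u, s <= u -> u <= T -> K <= dZ u) ->
  Z x -> mdist (f s) x = dZ s -> Z y -> mdist (f T) y = dZ T ->
  6 * q * mdist x y <= 3 * (T - s) + 2 * q * (Q + dZ T).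
Proof.
have [hq hQ] : 1 <= q /\ 0 <= Q by []; have q0 : 0 < q by lra.
elim: n s x => [|n IH] s x s0 sT Tn far Zx xs Zy yT.
  have eqTs : T = s by apply/eqP; rewrite eq_le sT andbT -subr_le0.
  have near : mdist (f s) (f T) <= dZ s.
    by rewrite eqTs mdistxx; exact/pdist_ge0/ray_image_nonempty.
  exact: short_drift s0 sT (far s (lexx s) sT) near Zx xs Zy yT.
have [near|away] := leP (mdist (f s) (f T)) (dZ s).
  exact: short_drift s0 sT (far s (lexx s) sT) near Zx xs Zy yT.
have cf := quasi_geodesic_ray_continuous (t := T) qf (mdist_lipschitz (f s)) s0.
have [|t] := IVT sT cf (_ : _ <= dZ s <= _).
  have := pdist_ge0 (f s) (ray_image_nonempty b).
  by rewrite /= mdistxx ge_min le_max => ->; rewrite (ltW away) orbT.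
rewrite in_itv /= => /andP[st tT] /= tr.
have [v v0 tz] := geodesic_ray_nearest (f t) gb.
have Zz : Z (b v) by exact: ray_imageP.
have xz : mdist x (b v) <= rho (dZ s).
  have near : mdist (f s) (f t) <= dZ s by rewrite tr.
  exact: cb near Zx xs Zz tz.
have Kr := far s (lexx s) sT; have [K3Q K3q _] := kappa_bounds.
have small := kappa_lt srho q1 Kr; have up := quasi_geodesic_upper s0 st.
have t0 : 0 <= t by exact: le_trans st.
(* The step takes time at least [2 q], which is at least [1]. *)
have r_le : 2 * dZ s <= 3 * (q * (t - s)) by lra.
have q2t : q * (2 * q) <= q * (t - s).
  have -> : q * (2 * q) = 2 * q ^+ 2 by ring.
  by lra.
have t_s : 2 * q <= t - s by rewrite -(ler_pM2l q0).
have drift : 6 * q * mdist x (b v) <= 3 * (t - s).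
  apply: (@le_trans _ _ (6 * q * rho (dZ s))).
    by rewrite ler_wpM2l// mulr_ge0// ltW.
  rewrite -(ler_pM2l q0).
  have -> : q * (6 * q * rho (dZ s)) = 2 * (3 * q ^+ 2 * rho (dZ s)) by ring.
  have -> : q * (3 * (t - s)) = 3 * (q * (t - s)) by ring.
  by lra.
have := IH t (b v) t0 tT _ _ Zz tz Zy yT.
rewrite -natr1 in Tn => /(_ ltac:(lra)).
move=> /(_ (fun u tu => far u (le_trans st tu))) drift'.
have := metric_triangle x (b v) y.
rewrite -(ler_pM2l (_ : 0 < 6 * q)) ?mulr_gt0//.
by rewrite mulrDr; lra.
Qed.

(** While [f] is far from [Z] its projection moves at most half as fast as [f]
    itself gets away from its starting point. *)
Lemma excursion_time s T : 0 <= s -> s <= T ->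
  (forall u, s <= u -> u <= T -> K <= dZ u) ->
  T - s <= 4 * q * (Q + dZ s + dZ T).
Proof.
have [hq hQ] : 1 <= q /\ 0 <= Q by []; have q0 : 0 < q by lra.
move=> s0 sT far.
have [v v0 sx] := geodesic_ray_nearest (f s) gb.
have [w w0 Ty] := geodesic_ray_nearest (f T) gb.
have Ts0 : 0 <= T - s by rewrite subr_ge0.
have drift := projection_drift s0 sT (ltW (archi_boundP Ts0)) far
  (ray_imageP b v0) sx (ray_imageP b w0) Ty.
have [lo _] := quasi_geodesic_ray_le qf s0 sT.
have ms0 := pdist_ge0 (f s) (ray_image_nonempty b).
have mT0 := pdist_ge0 (f T) (ray_image_nonempty b).
have t1 := metric_triangle (f s) (b v) (f T).
have t2 := metric_triangle (b v) (b w) (f T).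
rewrite (metric_sym (b w)) Ty in t2; rewrite sx in t1.
have : q^-1 * (T - s) <= Q + dZ s + mdist (b v) (b w) + dZ T by lra.
rewrite -(ler_pM2l (_ : 0 < 6 * q)) ?mulr_gt0//.
have -> : 6 * q * (q^-1 * (T - s)) = 6 * (T - s).
  by rewrite -(mulrA 6) (mulrA q) mulfV ?mul1r// gt_eqF.
have qs : 0 <= q * dZ s by rewrite mulr_ge0// ltW.
have qT : 0 <= q * dZ T by rewrite mulr_ge0// ltW.
have qQ : 0 <= q * Q by rewrite mulr_ge0// ltW.
by lra.
Qed.

Lemma pdist_ray_continuous s t : 0 <= s -> {within `[s, t], continuous (fun u => dZ u)}.
Proof.
exact: (quasi_geodesic_ray_continuous qf
  (pdist_lipschitz (ray_image_nonempty b))).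
Qed.

Lemma pdist_ray_start : dZ 0 <= 0.
Proof.
have [f0 _ _] := qf; have [b0 _] := gb.
rewrite f0 -b0; apply: le_trans (pdist_le (b 0) (ray_imageP b (lexx 0))) _.
by rewrite mdistxx.
Qed.

(** An excursion of [f] to distance more than [D] from [Z] begins and ends at distance
    [D], so it is short, and [f] cannot get far in the meantime. *)
Lemma quasi_geodesic_stability D t T : K <= D -> 0 <= t -> t <= T -> dZ T <= D ->
  dZ t <= D + Q + 4 * q ^+ 2 * (Q + 2 * D).
Proof.
have [hq hQ] : 1 <= q /\ 0 <= Q by []; have q0 : 0 < q by lra.
have [K3Q K3q K_ge3] := kappa_bounds.
move=> KD t0 tT TD.
have QD0 : 0 <= 4 * q ^+ 2 * (Q + 2 * D).
  by rewrite mulr_ge0 ?mulr_ge0 ?exprn_ge0//; lra.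
have [tD|Dt] := leP (dZ t) D; first by lra.
have D0 : dZ 0 <= D by have := pdist_ray_start; lra.
have [s [/andP[s0 st] sD sP]] :=
  last_passage t0 (pdist_ray_continuous (t := t) (lexx 0)) D0 Dt.
have [u [/andP[tu uT] uD uP]] :=
  first_passage tT (pdist_ray_continuous (t := T) t0) Dt TD.
have far v : s <= v -> v <= u -> K <= dZ v.
  move=> sv vu; apply: le_trans KD _.
  have [vt|tv] := leP v t.
    move: sv; rewrite le_eqVlt => /orP[/eqP<-|/sP/(_ vt)/ltW//].
    by rewrite sD.
  move: vu; rewrite le_eqVlt => /orP[/eqP->|/(uP _ (ltW tv))/ltW//].
  by rewrite uD.
have := excursion_time s0 (le_trans st tu) far; rewrite sD uD => us.
have up := quasi_geodesic_upper s0 st; rewrite metric_sym in up.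
have lip := pdist_lipschitz (ray_image_nonempty b) (f t) (f s); rewrite sD in lip.
have : q * (t - s) <= q * (4 * q * (Q + D + D)) by rewrite ler_pM2l//; lra.
have -> : q * (4 * q * (Q + D + D)) = 4 * q ^+ 2 * (Q + 2 * D) by ring.
by lra.
Qed.

(** Since the last time at distance [K] the ray has been on an excursion, which is
    short if it ends at distance [D]. This trades a rough bound [D] on the distance
    to [Z] for the sharp one, at a slightly earlier time. *)
Lemma quasi_geodesic_approach D T : 0 <= D -> 0 <= T -> dZ T <= D ->
  exists s, [/\ 0 <= s, s <= T, dZ s <= K & T - s <= 4 * q * (Q + K + D)].
Proof.
have [hq hQ] : 1 <= q /\ 0 <= Q by []; have q0 : 0 < q by lra.
have [K3Q K3q K_ge3] := kappa_bounds.
move=> D0 T0 TD.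
have [TK|KT] := leP (dZ T) K.
  exists T; split; rewrite // subrr mulr_ge0 ?mulr_ge0 ?(ltW q0)//; lra.
have K0 : dZ 0 <= K by have := pdist_ray_start; lra.
have [s [/andP[s0 sT] sK sP]] :=
  last_passage T0 (pdist_ray_continuous (t := T) (lexx 0)) K0 KT.
exists s; split; rewrite ?sK//.
have far u : s <= u -> u <= T -> K <= dZ u.
  rewrite le_eqVlt => /orP[/eqP<-|/sP + /[dup] uT]; first by rewrite sK.
  by move=> /[apply]/ltW.
have := excursion_time s0 sT far; rewrite sK.
move=> /le_trans; apply; rewrite ler_wpM2l//; first by rewrite mulr_ge0// ltW.
by lra.
Qed.

Lemma nearest_norm s x : 0 <= s -> mdist (f s) x <= K ->
  q^-1 * s - Q - K <= mdist o x.
Proof.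
move=> s0 sx; have [lo _] := quasi_geodesic_ray_norm qf s0.
by have := metric_triangle o x (f s); rewrite (metric_sym x); lra.
Qed.

Lemma set_dist_approach s r : 0 <= s -> dZ s <= K -> r <= q^-1 * s - Q - K ->
  (set_dist (ray_image f) (Z `&` outside_ball o r) <= K%:E)%E.
Proof.
move=> s0 sK rs; have [v v0 sv] := geodesic_ray_nearest (f s) gb.
rewrite -sv in sK.
apply: (@set_dist_le _ _ _ _ (f s) (b v)) => //; first exact: ray_imageP.
split; first exact: ray_imageP.
by apply: le_trans rs _; exact: nearest_norm.
Qed.

End QuasiGeodesicImage.

(** * Rerouting quasi-geodesic rays *)

Section Glue.
Context {R : realType} (X : metricType R).

Definition glue (T : R) (f g : R -> X) (u : R) : X := if u <= T then f u else g u.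

Lemma glue_le T f g u : u <= T -> glue T f g u = f u.
Proof. by rewrite /glue => ->. Qed.

Lemma glue_ge T f g u : f T = g T -> T <= u -> glue T f g u = g u.
Proof.
rewrite /glue => fg Tu; case: leP => // uT.
by have -> : u = T by apply/eqP; rewrite eq_le uT.
Qed.

Lemma glue_continuous (a T : R) f g : f T = g T ->
  {within `[a, T]%classic, continuous f} ->
  {within `[T, +oo[%classic, continuous g} ->
  {within `[a, +oo[%classic, continuous (glue T f g)}.
Proof.
move=> fg /within_continuous_mdistP cf /within_continuous_mdistP cg.
apply/within_continuous_mdistP => x; rewrite /= in_itv /= andbT => ax e e0.
have fP : x <= T -> exists2 d, 0 < d & forall y, a <= y -> y <= T ->
    `|x - y| < d -> mdist (f x) (f y) < e.
  move=> xT; have [|d d0 dP] := cf x _ e e0; first by rewrite /= in_itv /= ax.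
  by exists d => // y ay yT; apply: dP; rewrite /= in_itv /= ay.
have gP : T <= x -> exists2 d, 0 < d & forall y, T <= y ->
    `|x - y| < d -> mdist (g x) (g y) < e.
  move=> Tx; have [|d d0 dP] := cg x _ e e0; first by rewrite /= in_itv /= Tx.
  by exists d => // y Ty; apply: dP; rewrite /= in_itv /= Ty.
have [xT|Tx|xT] := ltgtP x T.
- have [d d0 dP] := fP (ltW xT); exists (Num.min d (T - x)).
    by rewrite lt_min d0 subr_gt0.
  move=> y; rewrite /= in_itv /= andbT lt_min => ay /andP[xyd xyT].
  have yT : y <= T.
    by have := ler_norm (y - x); rewrite distrC; lra.
  by rewrite !glue_le ?(ltW xT)//; exact: dP.
- have [d d0 dP] := gP (ltW Tx); exists (Num.min d (x - T)).
    by rewrite lt_min d0 subr_gt0.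
  move=> y; rewrite /= in_itv /= andbT lt_min => ay /andP[xyd xyT].
  have yT : T <= y by have := ler_norm (x - y); lra.
  by rewrite !glue_ge ?(ltW Tx)//; exact: dP.
- subst T; have [d d0 dP] := fP (lexx x); have [d' d'0 d'P] := gP (lexx x).
  exists (Num.min d d'); first by rewrite lt_min d0.
  move=> y; rewrite /= in_itv /= andbT lt_min => ay /andP[xyd xyT].
  have [yT|/ltW Ty] := leP y x.
    by rewrite !glue_le//; exact: dP.
  by rewrite !glue_ge//; exact: d'P.
Qed.

End Glue.

Section Detour.
Context {R : realType} (X : metricType R) (o : X).
Variables (f g sigma : R -> X) (q Q T v : R).
Hypotheses (q1 : 1 <= q) (Q0 : 0 <= Q) (qf : quasi_geodesic_ray o q Q f)
  (gg : geodesic_ray o g) (T0 : 0 <= T) (v0 : 0 <= v).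

Local Notation L := (mdist (f T) (g v)).

Hypotheses (sigma0 : sigma 0 = f T) (sigmaL : sigma L = g v)
  (sigma_iso : {in `[0, L] &, forall s t, mdist (sigma s) (sigma t) = `|s - t|}).

Definition detour : R -> X :=
  glue T f (glue (T + L) (fun u => sigma (u - T)) (fun u => g (v + (u - (T + L))))).

Lemma detour_start u : u <= T -> detour u = f u.
Proof. exact: glue_le. Qed.

Lemma detour_bridge c : 0 <= c -> c <= L -> detour (T + c) = sigma c.
Proof.
move=> c0 cL; rewrite /detour glue_ge ?lerDl//.
  by rewrite glue_le ?lerD2l// [T + c]addrC addrK.
by rewrite glue_le ?lerDl ?mdist_ge0// subrr sigma0.
Qed.

Lemma detour_end h : 0 <= h -> detour (T + L + h) = g (v + h).
Proof.
move=> h0; have L0 : 0 <= L by exact: mdist_ge0.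
rewrite /detour glue_ge.
- rewrite glue_ge ?lerDl//; first by rewrite [T + L + h]addrC addrK.
  by rewrite [T + L]addrC addrK subrr addr0.
- by rewrite glue_le ?lerDl// subrr sigma0.
- by rewrite -addrA lerDl addr_ge0.
Qed.

Lemma sigma_mdist s t : 0 <= s -> s <= t -> t <= L ->
  mdist (sigma s) (sigma t) = t - s.
Proof.
move=> s0 st tL; rewrite sigma_iso ?in_itv /=.
- by rewrite distrC ger0_norm// subr_ge0.
- by rewrite s0 (le_trans st).
- by rewrite (le_trans s0).
Qed.

Lemma g_mdist s t : 0 <= s -> s <= t -> mdist (g s) (g t) = t - s.
Proof.
move=> s0 st; rewrite (geodesic_ray_mdist gg)//; last exact: le_trans st.
by rewrite distrC ger0_norm// subr_ge0.
Qed.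

Lemma detour_continuous : {within `[0, +oo[%classic, continuous detour}.
Proof.
have L0 : 0 <= L by exact: mdist_ge0.
apply: glue_continuous.
- by rewrite glue_le ?lerDl// subrr sigma0.
- case: qf => _ cf _; apply: continuous_subspaceW cf => u /=.
  by rewrite !in_itv /= andbT => /andP[].
apply: glue_continuous.
- by rewrite [T + L]addrC addrK subrr addr0.
- apply: isometry_within_continuous => s t /=; rewrite !in_itv /=.
  move=> /andP[Ts sT] /andP[Tt tT]; rewrite sigma_iso ?in_itv /=.
  + by congr `|_|; lra.
  + by apply/andP; split; lra.
  + by apply/andP; split; lra.
- apply: isometry_within_continuous => s t /=; rewrite !in_itv /= !andbT.
  move=> Ts Tt; rewrite (geodesic_ray_mdist gg).
  + by congr `|_|; lra.
  + by rewrite addr_ge0// subr_ge0.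
  + by rewrite addr_ge0// subr_ge0.
Qed.

(** The bridge almost minimises the distance to the tail of [g], with a bonus for
    leaving [f] early. Being content with an additive error of [1] avoids any
    discussion of whether the minimum is attained. *)
Hypothesis almost_minimal : forall t w, 0 <= t -> t <= T -> v <= w ->
  L + (2 * q)^-1 * (T - t) <= mdist (f t) (g w) + 1.

(** If [s] is on [f] and [t] beyond it, almost minimality bounds the time from [s] to
    the end of the bridge by the distance; the triangle inequality then bounds the
    time spent on [g], which is a geodesic. *)
Lemma detour_lower s t : 0 <= s -> s <= t ->
  t - s <= 5 * q ^+ 2 * (mdist (detour s) (detour t) + (Q + 1)).
Proof.
move=> s0 st; have [[hq hQ] [hT hv]] : (1 <= q /\ 0 <= Q) /\ (0 <= T /\ 0 <= v) by [].
have q0 : 0 < q by lra.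
have L0 : 0 <= L by exact: mdist_ge0.
have t0 : 0 <= t by exact: le_trans st.
set d := mdist _ _; have d0 : 0 <= d by exact: mdist_ge0.
have lq x : 0 <= x -> x <= q * x by move=> x0; rewrite ler_peMl.
have lqq x : 0 <= x -> q * x <= q ^+ 2 * x.
  by move=> x0; rewrite expr2 -mulrA ler_wpM2l ?(ltW q0)//; exact: lq.
have := (lq d d0, lqq d d0, lq Q hQ, lqq Q hQ, lqq 1 ler01).
case=> [[[[d_q d_qq] Q_q] Q_qq] q_qq].
(* The time spent on [f] is controlled by the bonus. *)
have bonus x c : 0 <= x -> 0 <= c -> c + (2 * q)^-1 * x <= d + 1 ->
    c <= d + 1 /\ q * c + x <= 2 * (q * (d + 1)).
  move=> x0 c0 cx; have iq0 : 0 <= (2 * q)^-1 * x.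
    by rewrite mulr_ge0// invr_ge0 mulr_ge0// ltW.
  split; first by lra.
  have cancel : 2 * q * ((2 * q)^-1 * x) = x.
    by rewrite mulrA mulfV ?mul1r// mulf_neq0 ?pnatr_eq0 ?gt_eqF.
  have := cx; rewrite -(ler_pM2l (_ : 0 < 2 * q)) ?mulr_gt0// mulrDr cancel.
  by have := mulr_ge0 (ltW q0) c0; lra.
have [tT|/ltW Tt] := leP t T.
  have sT : s <= T by exact: le_trans tT.
  have [lo _] := quasi_geodesic_ray_le qf s0 st.
  move: lo; rewrite -(detour_start sT) -(detour_start tT) -/d.
  have cancel : q * (q^-1 * (t - s)) = t - s by rewrite mulrA mulfV ?mul1r ?gt_eqF.
  by rewrite -(ler_pM2l q0) mulrBr cancel; lra.
have [tTL|/ltW TLt] := leP t (T + L).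
  have c0 : 0 <= t - T by rewrite subr_ge0.
  have cL : t - T <= L by lra.
  have et : detour t = sigma (t - T) by rewrite -detour_bridge// addrC subrK.
  have [sT|/ltW Ts] := leP s T.
    have := almost_minimal s0 sT (lexx v).
    have := metric_triangle (f s) (sigma (t - T)) (g v).
    rewrite -sigmaL (sigma_mdist c0 cL (lexx L)) sigmaL.
    rewrite -et -(detour_start sT) -/d => tri am.
    have Ts0 : 0 <= T - s by rewrite subr_ge0.
    have [|_ b] := bonus (T - s) (t - T) Ts0 c0; first by lra.
    by have := lq _ c0; lra.
  have s_T : 0 <= s - T by rewrite subr_ge0.
  have es : detour s = sigma (s - T).
    by rewrite -detour_bridge//; [rewrite addrC subrK|lra].
  have : d = t - s.
    by rewrite /d es et sigma_mdist//; [lra|lra].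
  by lra.
have h0 : 0 <= t - (T + L) by rewrite subr_ge0.
set h := t - (T + L) in h0.
have et : detour t = g (v + h) by rewrite -detour_end// /h addrC subrK.
have vh : v <= v + h by rewrite lerDl.
have gh := g_mdist v0 vh.
have [sT|/ltW Ts] := leP s T.
  have := almost_minimal s0 sT vh; rewrite -et -(detour_start sT) -/d => am.
  have Ts0 : 0 <= T - s by rewrite subr_ge0.
  have [Ld b] := bonus (T - s) L Ts0 L0 am.
  have [_ up] := quasi_geodesic_ray_le qf s0 sT.
  have ed : d = mdist (f s) (g (v + h)) by rewrite /d et detour_start.
  have t1 := metric_triangle (g v) (f T) (g (v + h)).
  have t2 := metric_triangle (f T) (f s) (g (v + h)).
  rewrite gh (metric_sym (g v) (f T)) in t1; rewrite (metric_sym (f T) (f s)) in t2.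
  have hb : h <= L + q * (T - s) + Q + d by lra.
  have qb : q * (q * L + (T - s)) <= q * (2 * (q * (d + 1))) by rewrite ler_pM2l.
  have L_qq : L <= q * (q * L) by have := lq _ L0; have := lqq _ L0; rewrite expr2; lra.
  have -> : t - s = (T - s) + L + h by rewrite /h; ring.
  by have := lq _ L0; rewrite expr2; lra.
have s_T : 0 <= s - T by rewrite subr_ge0.
have [sTL|/ltW TLs] := leP s (T + L).
  have es : detour s = sigma (s - T).
    by rewrite -detour_bridge//; [rewrite addrC subrK|lra].
  have sL : s - T <= L by lra.
  have := almost_minimal T0 (lexx T) vh; rewrite subrr mulr0 addr0 => am.
  have ed : d = mdist (sigma (s - T)) (g (v + h)) by rewrite /d et es.
  have t1 := metric_triangle (f T) (sigma (s - T)) (g (v + h)).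
  have t2 := metric_triangle (g v) (sigma (s - T)) (g (v + h)).
  have i1 := sigma_mdist (lexx 0) s_T sL; rewrite sigma0 in i1.
  have i2 := sigma_mdist s_T sL (lexx L).
  rewrite sigmaL (metric_sym _ (g v)) in i2.
  by rewrite /h in gh; lra.
have h0' : 0 <= s - (T + L) by rewrite subr_ge0.
set h' := s - (T + L) in h0'.
have es : detour s = g (v + h') by rewrite -detour_end// /h' addrC subrK.
have : d = t - s.
  rewrite /d es et g_mdist; rewrite /h /h'; [ring|exact: addr_ge0|].
  by rewrite lerD2l lerB.
by lra.
Qed.

Lemma detour_lipschitz s t : T <= s -> s <= t ->
  mdist (detour s) (detour t) <= t - s.
Proof.
have on_bridge u w : T <= u -> u <= w -> w <= T + L ->
    mdist (detour u) (detour w) = w - u.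
  move=> Tu uw wL.
  have -> : detour u = sigma (u - T).
    by rewrite -detour_bridge; [rewrite addrC subrK|lra|lra].
  have -> : detour w = sigma (w - T).
    by rewrite -detour_bridge; [rewrite addrC subrK|lra|lra].
  by rewrite sigma_mdist; lra.
have on_end u w : T + L <= u -> u <= w -> mdist (detour u) (detour w) = w - u.
  move=> Lu uw.
  have -> : detour u = g (v + (u - (T + L))).
    by rewrite -detour_end; [rewrite addrC subrK|lra].
  have -> : detour w = g (v + (w - (T + L))).
    by rewrite -detour_end; [rewrite addrC subrK|lra].
  by have hv : 0 <= v by []; rewrite g_mdist; lra.
move=> Ts st; have [tL|/ltW Lt] := leP t (T + L); first by rewrite on_bridge.
have [sL|/ltW Ls] := leP s (T + L); last by rewrite on_end.
have := metric_triangle (detour s) (detour (T + L)) (detour t).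
by rewrite (on_bridge s (T + L)) ?(on_end (T + L) t)//; lra.
Qed.

Lemma detour_upper s t : 0 <= s -> s <= t ->
  mdist (detour s) (detour t) <= q * (t - s) + Q.
Proof.
move=> s0 st; have [hq hQ] : 1 <= q /\ 0 <= Q by [].
have lq x : 0 <= x -> x <= q * x by move=> x0; rewrite ler_peMl.
have [tT|/ltW Tt] := leP t T.
  have sT : s <= T by exact: le_trans tT.
  by rewrite !detour_start//; case: (quasi_geodesic_ray_le qf s0 st).
have [sT|/ltW Ts] := leP s T; last first.
  have := detour_lipschitz Ts st; have := lq (t - s).
  by rewrite subr_ge0 => /(_ st); lra.
have := metric_triangle (detour s) (detour T) (detour t).
have := detour_lipschitz (lexx T) Tt; have := lq (t - T).
rewrite subr_ge0 => /(_ Tt).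
rewrite (detour_start sT) (detour_start (lexx T)).
have [_ up] := quasi_geodesic_ray_le qf s0 sT.
by move: up; set a := mdist _ _; set b' := mdist _ _; set c := mdist _ _; lra.
Qed.

Lemma detour_quasi_geodesic : quasi_geodesic_ray o (5 * q ^+ 2) (Q + 1) detour.
Proof.
have [hq hQ] : 1 <= q /\ 0 <= Q by [].
have q20 : 0 < 5 * q ^+ 2 by rewrite mulr_gt0// exprn_gt0//; lra.
have qq : q <= 5 * q ^+ 2.
  have : q <= q ^+ 2 by rewrite expr2 ler_peMr//; lra.
  by lra.
split; first by rewrite detour_start//; case: qf.
  exact: detour_continuous.
have bounds s t : 0 <= s -> s <= t ->
    (5 * q ^+ 2)^-1 * (t - s) - (Q + 1) <= mdist (detour s) (detour t)
      <= 5 * q ^+ 2 * (t - s) + (Q + 1).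
  move=> s0 st; apply/andP; split.
    by rewrite lerBlDr ler_pdivrMl//; exact: detour_lower.
  apply: le_trans (detour_upper s0 st) _; rewrite lerD ?ler_wpM2r ?subr_ge0//.
  by lra.
move=> s t; rewrite !inE /= !in_itv /= !andbT => s0 t0.
have [st|/ltW ts] := leP s t.
  by rewrite distrC ger0_norm ?subr_ge0//; exact: bounds.
by rewrite metric_sym ger0_norm ?subr_ge0//; exact: bounds.
Qed.

End Detour.

(** When [f] and [g] come within [D] of each other at distance [l] from the base
    point, [f] can be rerouted to follow [g] in the end, and if the bridge is well
    placed then the constants of the new ray do not depend on [D]. A bridge that
    minimises the distance between [f t] and [g w] alone would not do, since [f] might
    come back towards [g] just before the bridge; penalising late departures by
    [t / (2 q)] rules this out. Following [f] up to the level [l] costs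
    a penalty of about [l / 2] only, less than the length of a bridge from a point near
    the base point, so the departure time is still comparable to [l]. *)
Lemma exists_detour (R : realType) (X : metricType R) (o : X)
    (f g : R -> X) (q Q D l t1 : R) :
  geodesic_space X -> 1 <= q -> 0 <= Q ->
  quasi_geodesic_ray o q Q f -> geodesic_ray o g ->
  0 <= t1 -> 0 <= l -> mdist o (f t1) = l -> mdist (f t1) (g l) <= D ->
  exists (h : R -> X) (T S v : R),
    [/\ quasi_geodesic_ray o (5 * q ^+ 2) (Q + 1) h,
        l / 2 - 2 * Q - D - 1 <= q * T,
        forall u, u <= T -> h u = f u,
        0 <= T &
        [/\ 0 <= S, 0 <= v & forall u, 0 <= u -> h (S + u) = g (v + u)]].
Proof.
move=> geo q1 Q0 qf gg t10 l0 ft1 D_near.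
have q0 : 0 < q by lra.
have iq0 : 0 <= (2 * q)^-1 by rewrite invr_ge0 mulr_ge0// ltW.
have iq_q x : (2 * q)^-1 * (q * x) = x / 2.
  by rewrite invfM -mulrA (mulrA q^-1) mulVf ?gt_eqF// mul1r mulrC.
pose cost t w := mdist (f t) (g w) + (2 * q)^-1 * t.
pose costs := [set cost p.1 p.2 | p in [set p : R * R |
  [/\ 0 <= p.1, p.1 <= t1 & l <= p.2]]].
have cost0 : has_inf costs.
  split; first by exists (cost t1 l); exists (t1, l).
  exists 0 => _ [[t w] /= [t0 _ _] <-].
  by rewrite addr_ge0 ?mdist_ge0// mulr_ge0.
have [_ [[T v] /= [T0 Tt1 lv] <-] almost] := inf_adherent (@ltr01 R) cost0.
have minimal t w : 0 <= t -> t <= t1 -> l <= w -> cost T v <= cost t w + 1.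
  move=> t0 tt1 lw; apply: ltW (lt_le_trans almost _); rewrite lerD2r.
  by apply: ge_inf; [case: cost0|exists (t, w)].
have v0 : 0 <= v by exact: le_trans lv.
have [sigma [sigma0 sigmaL sigma_iso]] := geo (f T) (g v).
exists (detour f g sigma T v), T, (T + mdist (f T) (g v)), v; split => //.
- apply: detour_quasi_geodesic => // t w t0 tT vw.
  have := minimal t w t0 (le_trans tT Tt1) (le_trans lv vw).
  by rewrite /cost mulrBr; lra.
- have := minimal t1 l t10 (lexx _) (lexx _); rewrite /cost.
  have [lo _] := quasi_geodesic_ray_norm qf t10.
  have [_ up] := quasi_geodesic_ray_norm qf T0.
  have tri := metric_triangle o (f T) (g v).
  rewrite (geodesic_ray_norm gg v0) in tri; rewrite ft1 in lo.
  have : t1 <= q * (l + Q).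
    by rewrite -ler_pdivrMl//; lra.
  move=> /(ler_wpM2l iq0); rewrite iq_q.
  have := mulr_ge0 iq0 T0.
  by lra.
- by move=> u uT; exact: detour_start.
- split => //; first by rewrite addr_ge0 ?mdist_ge0.
  by move=> u u0; exact: detour_end.
Qed.

(** * Coarse invariance of contraction and classes of rays *)

Section Sublinear.
Context {R : realType} (rho : R -> R).
Hypothesis srho : sublinear rho.

Lemma sublinear_ge1 t : 0 <= t -> 1 <= rho t.
Proof. by case: srho => r1 _ _ _ t0; apply: r1; rewrite in_itv /= t0. Qed.

Lemma sublinear_le s t : 0 <= s -> s <= t -> rho s <= rho t.
Proof.
case: srho => _ mono _ _ s0 st.
by apply: mono => //; rewrite in_itv /= ?s0 ?(le_trans s0).
Qed.

Lemma sublinear_concave (p x y : R) : 0 <= p -> p <= 1 -> 0 <= x -> 0 <= y ->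
  p * rho x + (1 - p) * rho y <= rho (p * x + (1 - p) * y).
Proof.
case: srho => _ _ conc _ p0 p1 x0 y0.
have := conc (Itv01 p0 p1) x y; rewrite !inE /= !in_itv /= !andbT => /(_ x0 y0).
rewrite !convRE /= mulrN mulrN -opprD lerN2.
by [].
Qed.

(** Concavity makes [rho] lie above the chord between [0] and [s + t], and
    [rho 0] is nonnegative. *)
Lemma sublinear_subadditive s t : 0 <= s -> 0 <= t ->
  rho (s + t) <= rho s + rho t.
Proof.
move=> s0 t0; have [st0|st0] := leP (s + t) 0.
  have -> : s = 0 by lra.
  by have := sublinear_ge1 (lexx 0); rewrite add0r; lra.
have r0 := sublinear_ge1 (lexx 0).
have part u : 0 <= u -> u <= s + t -> u / (s + t) * rho (s + t) <= rho u.
  move=> u0 ust; have p0 : 0 <= u / (s + t) by rewrite divr_ge0// ltW.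
  have p1 : u / (s + t) <= 1 by rewrite ler_pdivrMr// mul1r.
  have := sublinear_concave p0 p1 (ltW st0) (lexx 0).
  rewrite mulr0 addr0 mulfVK ?gt_eqF//; apply: le_trans.
  by rewrite lerDl mulr_ge0 ?subr_ge0//; lra.
have ps := part s s0 (ltac:(lra)); have pt := part t t0 (ltac:(lra)).
apply: le_trans (lerD ps pt).
by rewrite -mulrDl -mulrDl mulfV ?mul1r// gt_eqF.
Qed.

Lemma sublinear_scale A : 1 <= A -> sublinear (fun t => A * rho t).
Proof.
move=> A1; have A0 : 0 <= A by exact: le_trans A1.
case: (srho) => r1 mono conc lim; split.
- by move=> t /r1 rt; rewrite (le_trans A1)// ler_peMr.
- by move=> s t s0 t0 st; rewrite ler_wpM2l//; exact: mono.
- move=> p x y; rewrite !inE /= !in_itv /= !andbT => x0 y0.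
  have := conc p x y; rewrite !inE /= !in_itv /= !andbT => /(_ x0 y0).
  rewrite !convRE => /(ler_wpM2l A0); rewrite !mulrN mulrDr !mulrN.
  by rewrite !(mulrCA A).
- have -> : (fun t => A * rho t / t) = (fun t => A * (rho t / t)).
    by apply/funext => t; rewrite mulrA.
  by rewrite -[X in _ --> X](mulr0 A); apply: cvgMr.
Qed.

End Sublinear.

Section CoarseContraction.
Context {R : realType} (X : metricType R) (Z : set X) (rho : R -> R).
Hypotheses (geo : geodesic_space X) (srho : sublinear rho) (cZ : contracts Z rho)
  (Z_nearest : forall x, exists2 z, Z z & mdist x z = pdist x Z).

Lemma geodesic_point (x y : X) (r : R) : 0 <= r -> r <= mdist x y ->
  exists u, mdist x u = r /\ mdist u y = mdist x y - r.
Proof.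
move=> r0 rxy; have [g [g0 gL iso]] := geo x y; exists (g r).
have m0 := mdist_ge0 x y; split.
  rewrite -[X in mdist X]g0 iso ?in_itv /= ?lexx ?m0 ?r0//.
  by rewrite sub0r normrN ger0_norm.
rewrite -[X in mdist _ X = _]gL iso ?in_itv /= ?lexx ?m0 ?r0//.
by rewrite distrC ger0_norm ?subr_ge0.
Qed.

Lemma nonempty_of_nearest (x : X) : Z !=set0.
Proof. by have [z Zz _] := Z_nearest x; exists z. Qed.

(** Both [p] and [z] are close to the projection of the point at distance [d(x, Z)]
    from [x] on a geodesic towards [z]. *)
Lemma almost_nearest x p z (E : R) : 0 <= E -> Z p -> mdist x p = pdist x Z ->
  Z z -> mdist x z <= pdist x Z + E -> mdist p z <= rho (pdist x Z) + 2 * E.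
Proof.
move=> E0 Zp xp Zz xz; have Z0 := nonempty_of_nearest x.
have [u [xu uz]] := geodesic_point (pdist_ge0 x Z0) (pdist_le x Zz).
have [w Zw uw] := Z_nearest u.
have near : mdist x u <= pdist x Z by rewrite xu.
have := cZ near Zp xp Zw uw; have := pdist_le u Zz.
have := metric_triangle p w z; have := metric_triangle w u z.
by rewrite (metric_sym w u); lra.
Qed.

(** A geodesic from [x] to [y] leaves the ball to which contraction applies only for
    its last piece, of length at most [E]. This piece is again covered by contraction,
    unless it is close to [Z], where projecting moves points little. *)
Lemma coarse_contraction x y p p' (E : R) : 0 <= E ->
  mdist x y <= pdist x Z + E -> Z p -> mdist x p = pdist x Z ->
  Z p' -> mdist y p' = pdist y Z -> mdist p p' <= 3 * rho (pdist x Z) + 4 * E.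
Proof.
move=> E0 xy Zp xp Zp' yp'; have Z0 := nonempty_of_nearest x.
set r := pdist x Z in xy xp *; have r0 : 0 <= r by exact: pdist_ge0.
have rho1 := sublinear_ge1 srho r0.
have [yr|/ltW ry] := leP (mdist x y) r.
  by have := cZ yr Zp xp Zp' yp'; rewrite -/r; lra.
have [u [xu uy]] := geodesic_point r0 ry.
have [w Zw uw] := Z_nearest u.
have near : mdist x u <= r by rewrite xu.
have pw : mdist p w <= rho r by exact: cZ near Zp xp Zw uw.
have tri := metric_triangle p w p'.
have u_le := pdist_lipschitz Z0 u x; rewrite metric_sym xu -/r in u_le.
have u0 := pdist_ge0 u Z0.
have [Eu|uE] := leP E (pdist u Z).
  have near' : mdist u y <= pdist u Z by lra.
  have := cZ near' Zw uw Zp' yp'.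
  have := sublinear_le srho u0 u_le.
  by have := sublinear_subadditive srho r0 r0; lra.
have := metric_triangle w u p'; have := metric_triangle u y p'.
have := pdist_lipschitz Z0 y u.
by rewrite (metric_sym w u) (metric_sym y u) yp'; lra.
Qed.

(** The projections of a point to the two sets are at sublinear distance, so the
    contraction inequality passes from one to the other. *)
Lemma contracting_of_bounded (Z' : set X) (C : R) : closed Z' -> Z' !=set0 ->
  (forall z, Z' z -> pdist z Z <= C) -> (forall z, Z z -> pdist z Z' <= C) ->
  contracting Z'.
Proof.
move=> clZ' Z'0 Z'Z ZZ'; have [z0' Zz0'] := Z'0.
have Z0 := nonempty_of_nearest z0'.
have C0 : 0 <= C by exact: le_trans (pdist_ge0 z0' Z0) (Z'Z _ Zz0').
have rC := sublinear_ge1 srho C0.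
pose A := 10 + 10 * rho C + 18 * C.
exists (fun t => A * rho t); first by apply: sublinear_scale => //; rewrite /A; lra.
split=> // x y; rewrite !point_distE// lee_fin /= => xy.
set r' := pdist x Z' in xy *.
have r'0 : 0 <= r' by exact: pdist_ge0.
have ZZ'C u : pdist u Z <= pdist u Z' + C.
  apply/ler_addgt0Pr => e e0.
  have [|z Zz uz] := @pdist_lt _ _ u Z' (pdist u Z' + e) Z'0; first lra.
  by have := pdist_lipschitz Z0 u z; have := Z'Z _ Zz; lra.
have Z'ZC u : pdist u Z' <= pdist u Z + C.
  have [z Zz uz] := Z_nearest u.
  by have := pdist_lipschitz Z'0 u z; have := ZZ' _ Zz; lra.
set a := rho (r' + C).
have N0 : 0 <= r' + C by lra.
have a_le : a <= rho r' + rho C by exact: sublinear_subadditive.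
have r'1 := sublinear_ge1 srho r'0.
have [px Zpx xpx] := Z_nearest x; have [py Zpy ypy] := Z_nearest y.
have rx := ZZ'C x; have rx' := Z'ZC x; rewrite -/r' in rx rx'.
have rhox : rho (pdist x Z) <= a by apply: sublinear_le => //; exact: pdist_ge0.
have rhoy : rho (pdist y Z) <= 2 * a.
  have : pdist y Z <= (r' + C) + (r' + C).
    by have := pdist_lipschitz Z0 y x; rewrite metric_sym; lra.
  move=> /(sublinear_le srho (pdist_ge0 y Z0)).
  by have := sublinear_subadditive srho N0 N0; rewrite -/a; lra.
have pxy : mdist px py <= 3 * a + 4 * C.
  have xyC : mdist x y <= pdist x Z + C by lra.
  by have := coarse_contraction C0 xyC Zpx xpx Zpy ypy; lra.
have proj u pu z' : Z pu -> mdist u pu = pdist u Z -> Z' z' ->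
    mdist u z' = pdist u Z' -> mdist pu z' <= rho (pdist u Z) + 5 * C.
  move=> Zpu upu Zz' uz'; have [z Zz z'z] := Z_nearest z'.
  have z'C := Z'Z _ Zz'.
  have C20 : 0 <= 2 * C by rewrite mulr_ge0.
  have uz : mdist u z <= pdist u Z + 2 * C.
    by have := Z'ZC u; have := metric_triangle u z' z; lra.
  have := almost_nearest C20 Zpu upu Zz uz.
  by have := metric_triangle pu z z'; rewrite (metric_sym z z'); lra.
have near_px z' : (closest_proj Z' x `|` closest_proj Z' y) z' ->
    mdist px z' <= 5 * a + 9 * C.
  have a1 : 1 <= a by exact: sublinear_ge1.
  case=> -[Zz']; rewrite point_distE// => -[uz'].
    by have := proj x px z' Zpx xpx Zz' uz'; lra.
  have := proj y py z' Zpy ypy Zz' uz'.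
  by have := metric_triangle px py z'; lra.
apply: ge_ereal_sup => _ [[z w] [/= /near_px zx /near_px wx] <-].
rewrite lee_fin; have := metric_triangle z px w; rewrite (metric_sym z px).
have : 10 * rho C + 18 * C <= (10 * rho C + 18 * C) * rho r'.
  by rewrite ler_peMr//; lra.
by rewrite /A; lra.
Qed.

End CoarseContraction.

Section Classes.
Context {R : realType} (X : metricType R) (o : X).
Hypothesis geo : geodesic_space X.
Implicit Types (f g h : R -> X) (a : contracting_boundary o).

Lemma equivalent_raysP f g : equivalent_rays f g <-> exists C : R,
  (forall s, 0 <= s -> pdist (f s) (ray_image g) <= C) /\
  (forall s, 0 <= s -> pdist (g s) (ray_image f) <= C).
Proof.
rewrite /equivalent_rays hausdorff_bounded.
have fn h := ray_image_nonempty h.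
split => -[C [fg gf]]; exists C; split.
- by move=> s s0; rewrite -lee_fin -point_distE//; apply/fg/ray_imageP.
- by move=> s s0; rewrite -lee_fin -point_distE//; apply/gf/ray_imageP.
- move=> _ [s + <-]; rewrite /= in_itv /= andbT => s0.
  by rewrite point_distE// lee_fin fg.
- move=> _ [s + <-]; rewrite /= in_itv /= andbT => s0.
  by rewrite point_distE// lee_fin gf.
Qed.

Lemma equivalent_rays_sym f g : equivalent_rays f g -> equivalent_rays g f.
Proof. by move=> /equivalent_raysP[C [fg gf]]; apply/equivalent_raysP; exists C. Qed.

Lemma equivalent_rays_trans f g h : equivalent_rays f g -> equivalent_rays g h ->
  equivalent_rays f h.
Proof.
move=> /equivalent_raysP[C [fg gf]] /equivalent_raysP[D [gh hg]].
apply/equivalent_raysP; exists (C + 1 + D).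
have step (k l m : R -> X) (C' D' : R) :
    (forall s, 0 <= s -> pdist (k s) (ray_image l) <= C') ->
    (forall s, 0 <= s -> pdist (l s) (ray_image m) <= D') ->
    forall s, 0 <= s -> pdist (k s) (ray_image m) <= C' + 1 + D'.
  move=> kl lm s s0; have := kl s s0 => kls.
  have [|_ [t + <-] st] := @pdist_lt _ _ (k s) (ray_image l) (C' + 1)
    (ray_image_nonempty l); first lra.
  rewrite /= in_itv /= andbT => t0.
  have := pdist_lipschitz (ray_image_nonempty m) (k s) (l t).
  by have := lm t t0; lra.
split => s s0; first exact: (step f g h C D).
by have := step h g f D C hg gf s s0; lra.
Qed.

Lemma in_class_contracting f a : in_class f a -> contracting_ray o f.
Proof.
by rewrite /in_class; case: a => A /=; rewrite inE => -[g cg ->] [].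
Qed.

Lemma in_class_equivalent f g a : in_class f a -> in_class g a ->
  equivalent_rays f g.
Proof.
rewrite /in_class; case: a => A /=; rewrite inE => -[h ch ->] [_ hf] [_ hg].
exact: equivalent_rays_trans (equivalent_rays_sym hf) hg.
Qed.

Lemma equivalent_in_class f g a : in_class f a -> contracting_ray o g ->
  equivalent_rays f g -> in_class g a.
Proof.
rewrite /in_class; case: a => A /=; rewrite inE => -[h ch ->] [_ hf] cg fg.
by split => //; exact: equivalent_rays_trans fg.
Qed.

Lemma in_class_inj f g a c : in_class f a -> in_class g c ->
  equivalent_rays f g -> a = c.
Proof.
move=> fa gc fg; apply: val_inj; apply/seteqP; split => h ha.
  have hc := in_class_equivalent fa ha.
  apply: (equivalent_in_class gc (in_class_contracting ha)).
  exact: equivalent_rays_trans (equivalent_rays_sym fg) hc.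
have hc := in_class_equivalent gc ha.
apply: (equivalent_in_class fa (in_class_contracting ha)).
exact: equivalent_rays_trans hc.
Qed.

(** Near a given point only a bounded initial part of a quasi-geodesic ray
    matters, and its image is compact. *)
Lemma quasi_geodesic_ray_closed q Q f : 1 <= q -> quasi_geodesic_ray o q Q f ->
  closed (ray_image f).
Proof.
move=> q1 qf p clp; have q0 : 0 < q by lra.
pose T := q * (mdist o p + 1 + Q).
have cT : closed (f @` `[0, T]%classic).
  apply: compact_closed; first exact: metric_hausdorff.
  apply: continuous_compact; last exact: segment_compact.
  case: qf => _ cf _; apply: continuous_subspaceW cf => u /=.
  by rewrite !in_itv /= andbT => /andP[].
suff : closure (f @` `[0, T]%classic) p.
  move=> /cT[t + <-]; rewrite /= in_itv /= => /andP[t0 _]; exact: ray_imageP.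
move=> B Bp; have b1 : nbhs p (B `&` ball p 1).
  by apply: filterI => //; apply: nbhsx_ballx.
have [_ [[t + <-] [Bt]]] := clp _ b1; rewrite /= in_itv /= andbT ballEmdist /= => t0 pt.
exists (f t); split => //; exists t => //=; rewrite in_itv /= t0 /=.
have [lo _] := quasi_geodesic_ray_norm qf t0.
rewrite /T -ler_pdivrMl//.
by have := metric_triangle o p (f t); lra.
Qed.

(** The rays [f] and [g] differ only by bounded pieces, so they are at bounded
    Hausdorff distance; this also makes [f] contracting. *)
Lemma eventually_in_class q Q f g a S v : 1 <= q -> 0 <= Q ->
  quasi_geodesic_ray o q Q f -> geodesic_ray o g -> in_class g a ->
  0 <= S -> 0 <= v -> (forall u, 0 <= u -> f (S + u) = g (v + u)) ->
  in_class f a.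
Proof.
move=> q1 Q0 qf gg ga S0 v0 fg; have q0 : 0 < q by lra.
pose C := q * S + Q + v; have qS : 0 <= q * S by rewrite mulr_ge0// ltW.
have fSgv : f S = g v by have := fg 0 (lexx 0); rewrite !addr0.
have fC s : 0 <= s -> pdist (f s) (ray_image g) <= C.
  move=> s0; have [Ss|/ltW sS] := leP S s.
    have sS : 0 <= s - S by rewrite subr_ge0.
    have -> : f s = g (v + (s - S)) by rewrite -fg// addrC subrK.
    apply: le_trans (pdist_le _ (ray_imageP g (addr_ge0 v0 sS))) _.
    by rewrite mdistxx /C; lra.
  apply: le_trans (pdist_le _ (ray_imageP g v0)) _; rewrite -fSgv.
  have [_ up] := quasi_geodesic_ray_le qf s0 sS.
  have : q * (S - s) <= q * S by rewrite ler_wpM2l ?(ltW q0)//; lra.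
  by rewrite /C; lra.
have gC t : 0 <= t -> pdist (g t) (ray_image f) <= C.
  move=> t0; have [vt|/ltW tv] := leP v t.
    have vt0 : 0 <= t - v by rewrite subr_ge0.
    have -> : g t = f (S + (t - v)) by rewrite fg// addrC subrK.
    apply: le_trans (pdist_le _ (ray_imageP f (addr_ge0 S0 vt0))) _.
    by rewrite mdistxx /C; lra.
  apply: le_trans (pdist_le _ (ray_imageP f S0)) _; rewrite fSgv.
  rewrite (geodesic_ray_mdist gg)// ler0_norm ?subr_le0//.
  by rewrite /C; lra.
have eq_gf : equivalent_rays g f by apply/equivalent_raysP; exists C.
apply: (equivalent_in_class ga _ eq_gf); split; first by exists q, Q.
have [_ [rho srho crho]] := in_class_contracting ga.
have crho' := contracting_with_contracts (ray_image_nonempty g) crho.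
have nearest x : exists2 z, ray_image g z & mdist x z = pdist x (ray_image g).
  by have [t t0 xt] := geodesic_ray_nearest x gg; exists (g t) => //; exact: ray_imageP.
apply: (contracting_of_bounded geo srho crho' nearest (C := C)).
- exact: quasi_geodesic_ray_closed qf.
- exact: ray_image_nonempty.
- by move=> _ [s + <-]; rewrite /= in_itv /= andbT; exact: fC.
- by move=> _ [s + <-]; rewrite /= in_itv /= andbT; exact: gC.
Qed.

End Classes.

(** * Neighbourhood bases of the contracting boundary *)

Section BoundaryMetrizable.
Context {R : realType} (X : metricType R) (o : X).
Variables (b : contracting_boundary o -> R -> X)
  (rho : contracting_boundary o -> R -> R).
Hypotheses (geo : geodesic_space X) (choice : boundary_choice b rho).
Implicit Types (a c w x y z : contracting_boundary o) (f h : R -> X).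

Local Notation nbhd := (boundary_nbhd b rho).
Local Notation dray p c := (pdist p (ray_image (b c))).

Lemma choice_in_class c : in_class (b c) c. Proof. by case: (choice c). Qed.

Lemma choice_geodesic c : geodesic_ray o (b c). Proof. by case: (choice c). Qed.

Lemma choice_sublinear c : sublinear (rho c). Proof. by case: (choice c). Qed.

Lemma choice_contracts c : contracts (ray_image (b c)) (rho c).
Proof.
case: (choice c) => _ _ _; apply: contracting_with_contracts.
exact: ray_image_nonempty.
Qed.

(** A ray that stays at bounded distance from [b c] has only excursions of bounded
    duration, so it comes within [kappa] of [b c] again and again. *)
Lemma nbhd_center c r : nbhd c r c.
Proof.
move=> q Q q1 Q0 f qf fc; have q0 : 0 < q by lra.
have [D [fD _]] := (equivalent_raysP _ _).1
  (in_class_equivalent fc (choice_in_class c)).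
set K := kappa _ _ _.
have D0 : 0 <= D.
  exact: le_trans (pdist_ge0 _ (ray_image_nonempty (b c))) (fD 0 (lexx 0)).
have K0 : 0 <= K by have [+ _ _] := kappa_ge (rho c) q Q; rewrite -/K; lra.
pose N := q * (`|r| + Q + K).
have N0 : 0 <= N by rewrite mulr_ge0 ?(ltW q0)// !addr_ge0.
have T0 : 0 <= N + 4 * q * (Q + K + D).
  by rewrite addr_ge0// mulr_ge0 ?mulr_ge0 ?(ltW q0)// !addr_ge0.
have [s [s0 _ sK sT]] := quasi_geodesic_approach (choice_geodesic c)
  (choice_sublinear c) (@choice_contracts c) q1 Q0 qf D0 T0 (fD _ T0).
apply: (set_dist_approach (choice_geodesic c) qf s0 sK).
have : `|r| + Q + K <= q^-1 * s.
  by rewrite ler_pdivlMl//; move: sT; rewrite -/K -/N; lra.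
by have := ler_norm r; rewrite -/K; lra.
Qed.

Lemma nbhd_near a c r q Q f : 1 <= q -> 0 <= Q -> quasi_geodesic_ray o q Q f ->
  in_class f a -> nbhd c r a ->
  exists s, [/\ 0 <= s, dray (f s) c <= kappa (rho c) q Q + 1 &
    r - kappa (rho c) q Q - 1 <= mdist o (f s)].
Proof.
move=> q1 Q0 qf fa ac; have := ac q Q q1 Q0 f qf fa.
set K := kappa _ _ _ => Kdist.
have [|_ [p [[s + <-] [bp rp] sp]]] := @set_dist_near _ _ _ _ K (K + 1) Kdist.
  by rewrite ltrDl.
rewrite /= in_itv /= andbT => s0; exists s; split => //.
  exact: le_trans (pdist_le _ bp) (ltW sp).
have := metric_triangle o (f s) p; rewrite /outside_ball /= in rp.
by lra.
Qed.

(** The bound of [quasi_geodesic_stability] for a ray that comes within [kappa + 1];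
    the additional [1] is there because the distance of two sets need not be
    attained. *)
Definition tracking (c : contracting_boundary o) (q Q : R) : R :=
  let K := kappa (rho c) q Q + 1 in K + Q + 4 * q ^+ 2 * (Q + 2 * K).

Lemma nbhd_tracking a c r q Q f t : 1 <= q -> 0 <= Q ->
  quasi_geodesic_ray o q Q f -> in_class f a -> nbhd c r a -> 0 <= t ->
  q * t + Q < r - kappa (rho c) q Q - 1 -> dray (f t) c <= tracking c q Q.
Proof.
move=> q1 Q0 qf fa ac t0 tr.
have [s [s0 sK rs]] := nbhd_near q1 Q0 qf fa ac.
apply: (quasi_geodesic_stability (choice_geodesic c) (choice_sublinear c)
  (@choice_contracts c) q1 Q0 qf _ t0 _ sK); first by rewrite lerDl.
have [_ up] := quasi_geodesic_ray_norm qf s0.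
have q0 : 0 < q by lra.
rewrite leNgt; apply/negP => st; have : q * s <= q * t by rewrite ler_pM2l// ltW.
by lra.
Qed.

Lemma near_at_same_norm c (p : X) (D : R) : dray p c <= D ->
  mdist p (b c (mdist o p)) <= 2 * D.
Proof.
move=> pD; have [v v0 pv] := geodesic_ray_nearest p (choice_geodesic c).
have p0 := mdist_ge0 o p.
have := metric_triangle p (b c v) (b c (mdist o p)).
rewrite (geodesic_ray_mdist (choice_geodesic c) v0 p0).
have := metric_triangle o p (b c v); have := metric_triangle o (b c v) p.
rewrite (geodesic_ray_norm (choice_geodesic c) v0) (metric_sym (b c v) p) pv.
have [vp|pv'] := leP v (mdist o p).
  by rewrite ler0_norm ?subr_le0//; lra.
by rewrite gtr0_norm ?subr_gt0//; lra.
Qed.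

(** The ray comes close to [b c] beyond the level [l], so by stability it is also
    close to [b c] when it crosses that level, and then it must be near [b c l]. *)
Lemma nbhd_level a c r q Q f l : 1 <= q -> 0 <= Q ->
  quasi_geodesic_ray o q Q f -> in_class f a -> nbhd c r a -> 0 <= l ->
  l <= r - kappa (rho c) q Q - 1 ->
  exists t, [/\ 0 <= t, mdist o (f t) = l &
    mdist (f t) (b c l) <= 2 * tracking c q Q].
Proof.
move=> q1 Q0 qf fa ac l0 lr.
have [s [s0 sK rs]] := nbhd_near q1 Q0 qf fa ac.
have cf := quasi_geodesic_ray_continuous (t := s) qf (mdist_lipschitz o) (lexx 0).
have f0 : f 0 = o by case: qf.
have [|t] := IVT s0 cf (_ : _ <= l <= _).
  by rewrite /= f0 mdistxx ge_min l0 le_max (le_trans lr rs) orbT.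
rewrite in_itv /= => /andP[t0 ts] tl; exists t; split => //.
rewrite -{1}tl; apply: near_at_same_norm.
apply: (quasi_geodesic_stability (choice_geodesic c) (choice_sublinear c)
  (@choice_contracts c) q1 Q0 qf _ t0 ts sK).
by rewrite lerDl.
Qed.

Lemma kappa_ge3 c q Q : 1 <= q -> 3 <= kappa (rho c) q Q.
Proof.
move=> q1; have [_ + _] := kappa_ge (rho c) q Q; apply: le_trans.
by rewrite ler_peMr// exprn_ege1.
Qed.

Lemma tracking_ge c q Q : 1 <= q -> 0 <= Q -> kappa (rho c) q Q + 1 <= tracking c q Q.
Proof.
move=> q1 Q0; have := kappa_ge3 c Q q1; rewrite /tracking => K3.
have : 0 <= 4 * q ^+ 2 * (Q + 2 * (kappa (rho c) q Q + 1)).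
  by rewrite !mulr_ge0 ?exprn_ge0//; lra.
by lra.
Qed.

(** The level on the ray [b c] at which rays of constants at most [m] are rerouted;
    it is large compared to the distance between them there. *)
Definition detour_level c (m : R) : R := 2 * (3 * m + 4 * tracking c m m + 1).

Definition detour_radius c (m : R) : R := detour_level c m + kappa (rho c) m m + 1.

(** Both rays pass close to the point of [b y] at the level [detour_level y m],
    because their classes are in the neighbourhood of [y]. Only the length of the
    initial part that is kept depends on [y], and it is at least [m / q]. *)
Lemma nbhd_detour y w z f (m q Q : R) : 1 <= q -> q <= m -> 0 <= Q -> Q <= m ->
  nbhd y (detour_radius y m) w -> nbhd y (detour_radius y m) z ->
  quasi_geodesic_ray o q Q f -> in_class f w ->
  exists h (T : R), [/\ quasi_geodesic_ray o (5 * q ^+ 2) (Q + 1) h, in_class h z,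
    forall u, u <= T -> h u = f u, 0 <= T & m <= q * T].
Proof.
move=> q1 qm Q0 Qm wy zy qf fw.
have m1 : 1 <= m by lra.
have m0 : 0 <= m by lra.
have track := tracking_ge y m1 m0; have K3 := kappa_ge3 y m m1.
have l0 : 0 <= detour_level y m by rewrite /detour_level; lra.
have lr : detour_level y m <= detour_radius y m - kappa (rho y) m m - 1.
  by rewrite /detour_radius; lra.
have mf := quasi_geodesic_ray_weaken q1 qm Qm qf.
have mz := quasi_geodesic_ray_weaken (lexx 1) m1 m0
  (geodesic_ray_quasi_geodesic (choice_geodesic z)).
have [t [t0 tl near_f]] := nbhd_level m1 m0 mf fw wy l0 lr.
have [v [v0 vl near_z]] := nbhd_level m1 m0 mz (choice_in_class z) zy l0 lr.
rewrite (geodesic_ray_norm (choice_geodesic z) v0) in vl; rewrite vl in near_z.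
have near : mdist (f t) (b z (detour_level y m)) <= 4 * tracking y m m.
  have := metric_triangle (f t) (b y (detour_level y m)) (b z (detour_level y m)).
  by rewrite (metric_sym (b y _)); lra.
have [h [T [S [v' [qh Tl hf T0 [S0 v'0 hz]]]]]] :=
  exists_detour geo q1 Q0 qf (choice_geodesic z) t0 l0 tl near.
exists h, T; split => //.
  apply: (eventually_in_class geo _ _ qh (choice_geodesic z) (choice_in_class z)
    S0 v'0 hz); last by rewrite addr_ge0.
  by have : 1 <= q ^+ 2 by [exact: exprn_ege1]; lra.
by apply: le_trans Tl; rewrite /detour_level; lra.
Qed.

(** Partial sums, so that the neighbourhoods decrease with [n]. *)
Definition radius c (n : nat) : R := \sum_(i < n.+1) detour_radius c i.+1%:R.

Lemma detour_radius_ge c (n : nat) : n.+1%:R <= detour_radius c n.+1%:R.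
Proof.
have n1 : 1 <= n.+1%:R :> R by rewrite ler1n.
have n0 : 0 <= n.+1%:R :> R by [].
have := tracking_ge c n1 n0; have := kappa_ge3 c n.+1%:R n1.
by rewrite /detour_radius /detour_level; lra.
Qed.

Lemma detour_radius_le_radius c n : detour_radius c n.+1%:R <= radius c n.
Proof.
rewrite /radius big_ord_recr /= lerDr; apply: sumr_ge0 => i _.
exact: le_trans (detour_radius_ge c i).
Qed.

Lemma radius_ge c n : n%:R <= radius c n.
Proof.
apply: le_trans (detour_radius_le_radius c n).
by apply: le_trans (detour_radius_ge c n); rewrite ler_nat.
Qed.

Lemma radius_homo c i j : (i <= j)%N -> radius c i <= radius c j.
Proof.
elim: j => [|j IH]; first by rewrite leqn0 => /eqP->.
rewrite leq_eqVlt => /orP[/eqP->//|]; rewrite ltnS => /IH /le_trans; apply.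
rewrite /radius [leRHS]big_ord_recr /= lerDl.
exact: le_trans (detour_radius_ge c _).
Qed.

Definition base n c := nbhd c (radius c n).

Lemma base_decr i j c : (i <= j)%N -> base j c `<=` base i c.
Proof. by move=> ij; apply: boundary_nbhd_decr; exact: radius_homo. Qed.

Lemma base_sub_nbhd c (r : R) : exists n, base n c `<=` nbhd c r.
Proof.
have r0 : 0 <= `|r| by exact: normr_ge0.
exists (Num.bound `|r|); apply: boundary_nbhd_decr.
apply: le_trans (radius_ge c _); apply: le_trans (ler_norm r) _.
exact: ltW (archi_boundP r0).
Qed.

(** The ray [b y] tracks [b x] forever. *)
Lemma base_separated x y : (forall n, base n x y) -> x = y.
Proof.
move=> xy; pose D := tracking x 1 0.
have qy := geodesic_ray_quasi_geodesic (choice_geodesic y).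
have near t : 0 <= t -> dray (b y t) x <= D.
  move=> t0; have [n nU] := base_sub_nbhd x (t + kappa (rho x) 1 0 + 2).
  apply: (nbhd_tracking (lexx 1) (lexx 0) qy (choice_in_class y) (nU _ (xy n)) t0).
  by rewrite mul1r addr0; lra.
have close t : 0 <= t -> mdist (b y t) (b x t) <= 2 * D.
  move=> t0; have := near_at_same_norm (near t t0).
  by rewrite (geodesic_ray_norm (choice_geodesic y) t0).
apply: (in_class_inj (choice_in_class x) (choice_in_class y)).
apply/equivalent_raysP; exists (2 * D); split => t t0.
  apply: le_trans (close t t0); rewrite metric_sym.
  exact/pdist_le/ray_imageP.
apply: le_trans (close t t0); exact/pdist_le/ray_imageP.
Qed.

(** Let [f] represent a class [w] close to [y], and let [z] be close to both [x] and
    [y]. Rerouting [f] along [b z] gives a ray in the class [z] with constants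
    controlled by those of [f], so it tracks [b x] for a long time, and so does [f]
    itself. The contraction property of [b x] then brings [f] as close to [b x] as
    required. Constants [q], [Q] that are too large compared to [radius x n] impose no
    condition, so the ones that matter are bounded in terms of [x] and [n] alone. *)
Lemma base_swallow x n : exists m, forall y,
  base m x `&` base m y !=set0 -> base m y `<=` base n x.
Proof.
pose M := radius x n; have M0 : 0 <= M by exact: le_trans (radius_ge x n).
pose q' := 5 * M ^+ 2; pose Q' := M + 1.
pose D := tracking x q' Q'; pose K' := kappa (rho x) q' Q'.
pose B := K' + 1 + M + M ^+ 2 * (11 * M + 4 * D).
exists (Num.bound `|B|) => y [z [zx zy]] w wy q Q q1 Q0 f qf fw.
set m := Num.bound _ in zx zy wy.
have Bm : B <= m%:R.
  exact: le_trans (ler_norm B) (ltW (archi_boundP (normr_ge0 B))).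
rewrite -/M; set K := kappa (rho x) q Q.
have q0 : 0 < q by lra.
have [MK|KM] := leP M K.
  apply: (@set_dist_le _ _ _ _ (f 0) (b x M)); first exact: ray_imageP.
    split; first exact: ray_imageP.
    by rewrite /outside_ball /= (geodesic_ray_norm (choice_geodesic x)).
  by case: qf => -> _ _; rewrite (geodesic_ray_norm (choice_geodesic x)).
have [K3Q K3q _] := kappa_ge (rho x) q Q; rewrite -/K in K3Q K3q.
have qq : q <= q ^+ 2 by rewrite expr2 ler_peMr// ltW.
have qM : q <= M by lra.
have QM : Q <= M by lra.
have M1 : 1 <= M by lra.
have qMq : q ^+ 2 <= M ^+ 2 by rewrite ler_pXn2r ?nnegrE// ltW.
have q'1 : 1 <= q' by rewrite /q'; have : 1 <= M ^+ 2 by [exact: exprn_ege1]; lra.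
have Q'0 : 0 <= Q' by rewrite /Q'; lra.
have D_ge := tracking_ge x q'1 Q'0; rewrite -/D -/K' in D_ge.
have K'3 := kappa_ge3 x Q' q'1; rewrite -/K' in K'3.
have D0 : 0 <= D by lra.
have M2D0 : 0 <= M ^+ 2 * (11 * M + 4 * D).
  by rewrite mulr_ge0 ?exprn_ge0//; lra.
have mM : M <= m.+1%:R by rewrite -natr1; rewrite /B in Bm; lra.
have sub c : base m c `<=` nbhd c (detour_radius c m.+1%:R).
  exact/boundary_nbhd_decr/detour_radius_le_radius.
have [h [T [qh hz hf T0 mT]]] := nbhd_detour q1 (le_trans qM mM) Q0
  (le_trans QM mM) (sub _ _ wy) (sub _ _ zy) qf fw.
have qh' : quasi_geodesic_ray o q' Q' h.
  apply: quasi_geodesic_ray_weaken qh; rewrite /q' /Q'; lra.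
have [s [s0 sK ms]] := nbhd_near q'1 Q'0 qh' hz zx; rewrite -/K' in sK ms.
(* The last time before the detour at which [f] is known to be close to [b x]. *)
have [t [t0 tD mt]] : exists t, [/\ 0 <= t, dray (f t) x <= D &
    m%:R - K' - 1 - M <= q * t].
  have [sT|/ltW Ts] := leP s T.
    exists s; rewrite -hf//; split => //; first lra.
    have [_] := quasi_geodesic_ray_norm qf s0; rewrite -hf// => up.
    by have := radius_ge x m; lra.
  exists T; split => //; last by rewrite -natr1 in mT; lra.
  rewrite -hf//.
  apply: (quasi_geodesic_stability (choice_geodesic x) (choice_sublinear x)
    (@choice_contracts x) q'1 Q'0 qh' _ T0 Ts sK).
  by rewrite lerDl.
have [u [u0 ut uK tu]] := quasi_geodesic_approach (choice_geodesic x)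
  (choice_sublinear x) (@choice_contracts x) q1 Q0 qf D0 t0 tD.
rewrite -/K in uK tu.
apply: (set_dist_approach (choice_geodesic x) qf u0 uK); rewrite -/K.
suff : q * (M + Q + K) <= u by rewrite -ler_pdivlMl//; lra.
have qt : q ^+ 2 * (11 * M + 4 * D) <= q * t.
  apply: (@le_trans _ _ (M ^+ 2 * (11 * M + 4 * D))).
    by rewrite ler_wpM2r//; lra.
  by move: Bm; rewrite /B; lra.
have {}qt : q * (11 * M + 4 * D) <= t.
  by rewrite -(ler_pM2l q0) mulrA -expr2.
have qb : q * (5 * Q + 5 * K + M + 4 * D) <= q * (11 * M + 4 * D).
  by rewrite ler_pM2l//; lra.
by lra.
Qed.

Lemma boundary_metrizable : metrizable R (topological_boundary b rho).
Proof.
have [d [d0 d_eq0 d_sym d_tri d_open]] := @frink_metrization R _ base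
  (fun n c => @nbhd_center c (radius c n)) base_decr base_swallow base_separated.
exists d; split => // V; rewrite -d_open.
have -> : open V = boundary_open V by [].
split => oV c Vc.
  have [r r0 rV] := oV c Vc; have [n nr] := base_sub_nbhd c r.
  by exists n; exact: subset_trans rV.
have [n nV] := oV c Vc; exists (Num.max 1 (radius c n)).
  by rewrite lt_max ltr01.
apply: subset_trans nV; apply: boundary_nbhd_decr.
by rewrite le_max lexx orbT.
Qed.

End BoundaryMetrizable.

Theorem corollary1p2 (R : realType) (X : metricType R) (o : X)
    (hproper : proper_space X) (hgeodesic : geodesic_space X)
    (b : contracting_boundary o -> R -> X)
    (rho : contracting_boundary o -> R -> R)
    (hchoice : boundary_choice b rho) :
  metrizable R (topological_boundary b rho).
Proof. exact: boundary_metrizable. Qed.
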